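(* Let $\Gamma$ be a discrete abelian group (written additively) and let $A$ be a $C^*$-algebra equipped with closed subspaces $(A_\gamma)_{\gamma\in\Gamma}$ such that $$A_\gamma A_\eta\subseteq A_{\gamma+\eta},\qquad A_\gamma^*=A_{-\gamma}\qquad(\gamma,\eta\in\Gamma),$$ and the algebraic direct sum $A_{\mathrm{alg}}:=\bigoplus^{\mathrm{alg}}_{\gamma\in\Gamma}A_\gamma$ is dense in $A$. Assume moreover that the canonical projection $E_0:A_{\mathrm{alg}}\to A_0$, $E_0\big(\sum_\gamma a_\gamma\big):=a_0$, extends by continuity to a faithful conditional expectation $E:A\to A_0$. Then there exists a unique strongly continuous action $\widehat\alpha:\widehat\Gamma\to\mathrm{Aut}(A)$ such that for every $\gamma\in\Gamma$ $$A_\gamma=\{a\in A:\widehat\alpha_\chi(a)=\chi(\gamma)\,a\ \ \forall\chi\in\widehat\Gamma\}.$$ Moreover, $E$ is given by Haar averaging: $E(a)=\int_{\widehat\Gamma}\widehat\alpha_\chi(a)\,d\chi$ for all $a\in A$.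
   Context: $\widehat\Gamma$ is the compact Pontryagin dual of $\Gamma$, $d\chi$ its normalized Haar measure. The subspaces $A_\gamma$ are linearly independent, i.e. every element of $A_{\mathrm{alg}}\subseteq A$ has a unique expansion as a finite sum $\sum_\gamma a_\gamma$ with $a_\gamma\in A_\gamma$. Faithful means $E(a^*a)=0$ implies $a=0$. $\mathrm{Aut}(A)$ denotes $*$-automorphisms, and strong continuity means $\chi\mapsto\widehat\alpha_\chi(a)$ is norm continuous for each $a\in A$. *)

(* Defs.v *)
From HB Require Import structures.
From mathcomp Require Import all_boot all_order all_algebra.
From mathcomp Require Import all_classical all_reals all_analysis.
From mathcomp Require Export complex.

Set Implicit Arguments.
Unset Strict Implicit.
Unset Printing Implicit Defensive.

Import Order.TTheory GRing.Theory Num.Theory.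
Import numFieldNormedType.Exports.

Local Open Scope classical_set_scope.
Local Open Scope ring_scope.

(* C*-algebras, not assumed unital.  The ring structures of the library all
   have a unit, so the product is a separate operation.  The norm of a normed
   module over R[i] takes its values in R[i]. *)
HB.mixin Record isCstarAlgebra (R : realType) A
    of CompleteNormedModule R[i] A := {
  cmul : A -> A -> A ;
  star : A -> A ;
  cmulA : associative cmul ;
  cmulDl : left_distributive cmul +%R ;
  cmulDr : right_distributive cmul +%R ;
  cmulZl : forall (c : R[i]) (a b : A), cmul (c *: a) b = c *: cmul a b ;
  cmulZr : forall (c : R[i]) (a b : A), cmul a (c *: b) = c *: cmul a b ;
  starD : {morph star : a b / a + b} ;
  starZ : forall (c : R[i]) (a : A), star (c *: a) = conjc c *: star a ;
  starM : forall a b : A, star (cmul a b) = cmul (star b) (star a) ;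
  starK : involutive star ;
  norm_cmul : forall a b : A, `|cmul a b| <= `|a| * `|b| ;
  norm_star_cmul : forall a : A, `|cmul (star a) a| = `|a| ^+ 2
}.

#[short(type="cstarAlgType")]
HB.structure Definition CstarAlgebra (R : realType) :=
  {A of isCstarAlgebra R A & CompleteNormedModule R[i] A}.

Declare Scope cstar_scope.
Delimit Scope cstar_scope with cstar.
Notation "a ** b" := (cmul a b) (at level 40, left associativity) : cstar_scope.
Local Open Scope cstar_scope.

Section CstarNotions.
Variables (R : realType) (A : cstarAlgType R).

Definition linear_subspace (B : set A) : Prop :=
  B 0 /\ forall (c : R[i]) (a b : A), B a -> B b -> B (c *: a + b).

Definition star_automorphism (f : A -> A) : Prop :=
  [/\ linear f, {morph f : a b / a ** b}, {morph f : a / star a}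
    & bijective f].

Definition positive (a : A) : Prop := exists b : A, a = star b ** b.

Definition conditional_expectation (B : set A) (E : A -> A) : Prop :=
  [/\ linear E /\ (forall a, B (E a)),
      forall b, B b -> E b = b,
      forall a, `|E a| <= `|a|,
      forall a, positive a -> positive (E a)
    & forall b1 a b2, B b1 -> B b2 -> E (b1 ** a ** b2) = b1 ** E a ** b2].

Definition faithful (E : A -> A) : Prop :=
  forall a, E (star a ** a) = 0 -> a = 0.

End CstarNotions.

Section Grading.
Variables (R : realType) (G : zmodType) (A : cstarAlgType R).
Variable A_ : G -> set A.

(* The finitely supported families (a_g) with a_g in A_g; the associated sum
   is [\sum_(g \in setT) a g]. *)
Definition graded_family (a : G -> A) : Prop :=
  finite_set [set g | a g != 0] /\ forall g, A_ g (a g).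

Definition algebraic_sum : set A :=
  [set \sum_(g \in [set: G]) a g | a in graded_family].

Definition graded_independent : Prop :=
  forall a b : G -> A, graded_family a -> graded_family b ->
  \sum_(g \in [set: G]) a g = \sum_(g \in [set: G]) b g -> a = b.

(* [E] restricts on the algebraic direct sum to the projection onto A_0. *)
Definition extends_projection (E : A -> A) : Prop :=
  forall a : G -> A, graded_family a -> E (\sum_(g \in [set: G]) a g) = a 0.

End Grading.

Section Dual.
Variables (R : realType) (G : zmodType).

Record dual := Character {
  char_fun :> G -> R[i] ;
  char_norm : forall g, `|char_fun g| = 1 ;
  charD : forall g h, char_fun (g + h) = char_fun g * char_fun h }.

Lemma dualP (chi eta : dual) : char_fun chi = char_fun eta -> chi = eta.
Proof.
case: chi eta => [f nf fD] [g ng gD] /= fg; subst g.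
by congr Character; exact: Prop_irrelevance.
Qed.

HB.instance Definition _ := gen_eqMixin dual.
HB.instance Definition _ := gen_choiceMixin dual.

Fact one_norm (g : G) : `|1 : R[i]| = 1.
Proof. exact: normr1. Qed.
Fact one_charD (g h : G) : 1 = 1 * 1 :> R[i].
Proof. by rewrite mulr1. Qed.
Definition char_one : dual := Character one_norm one_charD.

Fact mul_norm (chi eta : dual) g : `|chi g * eta g| = 1.
Proof. by rewrite normrM !char_norm mulr1. Qed.
Fact mul_charD (chi eta : dual) g h :
  chi (g + h) * eta (g + h) = (chi g * eta g) * (chi h * eta h).
Proof. by rewrite !charD mulrACA. Qed.
Definition char_mul (chi eta : dual) : dual :=
  Character (mul_norm chi eta) (mul_charD chi eta).

Fact inv_norm (chi : dual) g : `|(chi g)^-1| = 1.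
Proof. by rewrite normfV char_norm invr1. Qed.
Fact inv_charD (chi : dual) g h :
  (chi (g + h))^-1 = (chi g)^-1 * (chi h)^-1.
Proof. by rewrite charD invfM. Qed.
Definition char_inv (chi : dual) : dual :=
  Character (inv_norm chi) (inv_charD chi).

Lemma char_neq0 (chi : dual) g : chi g != 0.
Proof. by rewrite -normr_eq0 char_norm oner_eq0. Qed.

Fact char_mulA : associative char_mul.
Proof. by move=> x y z; apply: dualP; apply/funext => g /=; rewrite mulrA. Qed.
Fact char_mul1g : left_id char_one char_mul.
Proof. by move=> x; apply: dualP; apply/funext => g /=; rewrite mul1r. Qed.
Fact char_mulg1 : right_id char_one char_mul.
Proof. by move=> x; apply: dualP; apply/funext => g /=; rewrite mulr1. Qed.
Fact char_mulVg : left_inverse char_one char_inv char_mul.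
Proof.
by move=> x; apply: dualP; apply/funext => g /=; rewrite mulVf ?char_neq0.
Qed.
Fact char_mulgV : right_inverse char_one char_inv char_mul.
Proof.
by move=> x; apply: dualP; apply/funext => g /=; rewrite mulfV ?char_neq0.
Qed.

HB.instance Definition _ := isGroup.Build dual
  char_mulA char_mul1g char_mulg1 char_mulVg char_mulgV.

HB.instance Definition _ := isPointed.Build dual char_one.

(* Compact subsets of the discrete group G are finite, so the compact-open
   topology of the dual is the topology of pointwise convergence. *)
HB.instance Definition _ := Topological.copy dual
  (initial_topology (char_fun : dual -> {ptws G -> R[i]^o})).

Definition borel_dual := g_sigma_algebraType (@open dual).
HB.instance Definition _ := Measurable.on borel_dual.

Definition translation_invariant (mu : set borel_dual -> \bar R) : Prop :=
  forall (chi : dual) (U : set borel_dual), measurable U ->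
  mu [set (chi * eta)%g | eta in U] = mu U.

Definition regular_borel (mu : set borel_dual -> \bar R) : Prop :=
  forall U : set borel_dual, measurable U ->
  mu U = ereal_inf [set mu O | O in [set O : set dual | open O /\ U `<=` O]] /\
  mu U = ereal_sup
           [set mu K | K in [set K : set dual | compact K /\ K `<=` U]].

Definition is_haar (mu : probability borel_dual R) : Prop :=
  translation_invariant mu /\ regular_borel mu.

End Dual.

Section Bochner.
Variables (R : realType) (d : measure_display) (X : measurableType d).
Variables (V : completeNormedModType R[i]).
Variable mu : {finite_measure set X -> \bar R}.

Definition simple_integral (s : X -> V) : V :=
  \sum_(v \in range s) (fine (mu (s @^-1` [set v])))%:C%C *: v.

(* [f] is Bochner integrable with integral [v]. *)
Definition is_bochner_integral (f : X -> V) (v : V) : Prop :=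
  exists s : nat -> {fimfun X >-> V},
  [/\ forall n w, measurable (s n @^-1` [set w]),
      {ae mu, forall x, s n x @[n --> \oo] --> f x},
      (\int[mu]_x (complex.Re `|f x - s n x|)%:E)%E @[n --> \oo] --> 0%E
    & simple_integral (s n) @[n --> \oo] --> v].

End Bochner.

Section DualAction.
Variables (R : realType) (G : zmodType) (A : cstarAlgType R).

Definition strongly_continuous_action (alpha : dual R G -> A -> A) : Prop :=
  [/\ forall chi, star_automorphism (alpha chi),
      forall chi eta : dual R G,
        alpha (chi * eta)%g = alpha chi \o alpha eta
    & forall a, continuous (alpha ^~ a)].

Definition has_spectral_subspaces (A_ : G -> set A)
    (alpha : dual R G -> A -> A) : Prop :=
  forall g, A_ g = [set a | forall chi : dual R G, alpha chi a = chi g *: a].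

End DualAction.

(* Main.v *)
(* A character [chi] acts on the algebraic direct sum by multiplying the degree
   [g] part by [chi g]; the point is that this twist is isometric.  Since [E] is
   invariant under it and faithful, the closure [D] of its graph in [A * A] has
   no element [(x, 0)] with [x <> 0].  If [b] is self-adjoint in the algebraic
   sum, with image [b'], and [|b'| < |b|], choose [s] between the squares of the
   two norms.  The function [|t^2 - s| + t^2 - s] vanishes at [b'] and not at
   [b], so applying it to [(b, b')] gives such an element.  The only functional
   calculus required is [sqrt (1 - x)] for [|x| <= 1], obtained as a limit of
   polynomials, so that no spectral theory enters.

   The spectral subspaces are recovered by averaging [chi g^-1 alpha_chi] over
   finitely many characters, which needs that characters separate the points
   of [G].  Translation invariance shows that the integral of a nontrivial
   [chi g] against Haar measure vanishes, whence the averaging formula. *)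
Require Import Defs.
From HB Require Import structures.
From mathcomp Require Import all_boot all_order all_algebra.
From mathcomp Require Import all_classical all_reals all_analysis.
From mathcomp Require Import complex.
From mathcomp Require Import measurable_realfun.
From mathcomp Require Import ring lra zify.

Set Implicit Arguments.
Unset Strict Implicit.
Unset Printing Implicit Defensive.

Import Order.TTheory GRing.Theory Num.Theory.
Import numFieldNormedType.Exports.

Local Open Scope classical_set_scope.
Local Open Scope ring_scope.
Local Open Scope cstar_scope.

(** * Real-valued norms *)

(** Since [A] may have no unit, [1 - X] is not an element of [A]. The calculus is therefore carried
    out on self-adjoint operators on [A], and vectors replace the unit: an operator identity is
    evaluated at [b] itself, where [|b b| = |b|^2] still sees the full norm of [b]. No order on [A]
    is used: the sharp bounds on an operator [T] come from a commuting [N] for which [T^2 + N^2] is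
    known.

    Isometry serves not only to extend the twist by continuity. An element of the algebraic sum is
    presented by many lists, and it is isometry that makes the twist depend on their sum alone.

    Uniqueness needs a norm bound for an arbitrary competing automorphism, whose definition contains
    none. Limits cannot be pushed through such a map, so the argument by closed relations is
    replaced there by a finite algebraic identity. *)

Lemma inv_succ_small (R : realType) (e : R) :
  0 < e -> exists N, forall n, (N <= n)%N -> n.+1%:R^-1 < e.
Proof.
move=> e0; exists (Num.trunc e^-1) => n Nn.
rewrite invf_plt ?posrE ?ltr0n //; apply: lt_le_trans (truncnS_gt _) _.
by rewrite ler_nat ltnS.
Qed.

Section RealNorm.
Variables (R : realType) (V : completeNormedModType R[i]).
Implicit Types x y z : V.

(* The norm of the library has values in [R[i]]. *)
Definition nm (x : V) : R := complex.Re `|x|.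

Lemma nmE x : `|x| = (nm x)%:C%C.
Proof. by rewrite /nm RRe_real // ger0_real. Qed.

Lemma nm_ge0 x : 0 <= nm x.
Proof. by rewrite -lecR -nmE; exact: normr_ge0. Qed.

Lemma nm0 : nm 0 = 0.
Proof. by rewrite /nm normr0. Qed.

Lemma nm_eq0 x : nm x = 0 -> x = 0.
Proof. by move=> h; apply/eqP; rewrite -normr_eq0 nmE h. Qed.

Lemma nmN x : nm (- x) = nm x.
Proof. by rewrite /nm normrN. Qed.

Lemma nmB x y : nm (x - y) = nm (y - x).
Proof. by rewrite /nm distrC. Qed.

Lemma nmD x y : nm (x + y) <= nm x + nm y.
Proof. by rewrite -lecR rmorphD /= -!nmE ler_normD. Qed.

Lemma nm_triangle y x z : nm (x - z) <= nm (x - y) + nm (y - z).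
Proof. by rewrite -[x - z](subrKA y) nmD. Qed.

Lemma nmZ (c : R[i]) x : nm (c *: x) = complex.Re `|c| * nm x.
Proof.
apply: complexI; rewrite -nmE normrZ nmE rmorphM /=; congr (_ * _).
Qed.

Lemma nmZr (c : R) x : nm (c%:C%C *: x) = `|c| * nm x.
Proof. by rewrite nmZ normc_def /= expr0n addr0 sqrtr_sqr. Qed.

Lemma nm_cvgP (T : Type) (F : set_system T) {FF : Filter F} (f : T -> V) l :
  (f x @[x --> F] --> l) <-> (forall e : R, 0 < e -> \forall t \near F, nm (f t - l) < e).
Proof.
rewrite cvgrPdist_lt; split => h e e0.
  have e0' : 0 < e%:C%C by rewrite ltcR.
  by apply: filterS (h _ e0') => t; rewrite nmE ltcR nmB.
(* In the order of [R[i]] a positive number has zero imaginary part, so [e] is real. *)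
move: (e0); rewrite ltcE => /andP[/eqP /= ie re].
have -> : e = (complex.Re e)%:C%C by rewrite RRe_real // gtr0_real.
by apply: filterS (h _ re) => t; rewrite nmE ltcR nmB.
Qed.

Lemma nm_cvg (u : nat -> V) l :
  (u n @[n --> \oo] --> l) <->
  (forall e : R, 0 < e -> exists N, forall n, (N <= n)%N -> nm (u n - l) < e).
Proof.
rewrite nm_cvgP; split => h e e0.
  by have [N _ hN] := h e e0; exists N => n Nn; exact: hN.
by have [N hN] := h e e0; exists N => // n; exact: hN.
Qed.

Lemma nm_cauchy (u : nat -> V) :
  (forall e : R, 0 < e -> exists N, forall m n, (N <= m)%N -> (N <= n)%N ->
    nm (u m - u n) < e) -> exists l : V, u n @[n --> \oo] --> l.
Proof.
move=> h; suff : cvg (u n @[n --> \oo]) by exists (lim (u n @[n --> \oo])).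
apply/cauchy_cvgP; apply: cauchy_exP => e e0.
move: (e0); rewrite ltcE => /andP[/eqP /= ie re].
have [N hN] := h _ re; exists (u N); exists N => // n /= Nn.
rewrite -ball_normE /ball_ /= nmE.
have -> : e = (complex.Re e)%:C%C by rewrite RRe_real // gtr0_real.
by rewrite ltcR hN.
Qed.

Lemma nm_closed (B : set V) x : closed B ->
  (forall e : R, 0 < e -> exists2 y, B y & nm (x - y) < e) -> B x.
Proof.
move=> cB h; apply: cB => U; rewrite nbhs_ballP => -[e /= e0 eU].
move: (e0); rewrite ltcE => /andP[/eqP /= ie re].
have [y By xy] := h _ re; exists y; split => //; apply: eU.
rewrite -ball_normE /ball_ /= nmE.
have -> : e = (complex.Re e)%:C%C by rewrite RRe_real // gtr0_real.
by rewrite ltcR.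
Qed.

Lemma nm_dense (B : set V) x (e : R) : dense B -> 0 < e ->
  exists2 y, B y & nm (x - y) < e.
Proof.
move=> dB e0; have e0' : 0 < e%:C%C by rewrite ltcR.
have [||y [+ By]] := dB (ball x e%:C%C).
- by exists x; exact: ballxx.
- exact: ball_open.
rewrite -ball_normE /ball_ /= nmE ltcR; by exists y.
Qed.

Lemma nm_small x : (forall e : R, 0 < e -> nm x < e) -> x = 0.
Proof.
move=> h; apply: nm_eq0; apply/eqP; rewrite eq_le nm_ge0 andbT leNgt.
by apply/negP => /h; rewrite ltxx.
Qed.

Lemma nm_lim_le (u : nat -> V) l (C : R) : u n @[n --> \oo] --> l ->
  (forall n, nm (u n) <= C) -> nm l <= C.
Proof.
move=> /nm_cvg ul uC; apply/ler_addgt0Pr => e /ul[N /(_ N (leqnn _)) h].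
have := nmD (u N) (l - u N); rewrite subrKC nmB => h2.
by have := uC N; lra.
Qed.

End RealNorm.

(** * Self-adjoint operators *)

Section CstarBasics.
Variables (R : realType) (A : cstarAlgType R).
Implicit Types (x y z a b : A) (r s : R) (T N X : A -> A).

Lemma cmulBl x y z : (x - y) ** z = x ** z - y ** z.
Proof. by rewrite -scaleN1r cmulDl cmulZl scaleN1r. Qed.

Lemma cmulBr x y z : x ** (y - z) = x ** y - x ** z.
Proof. by rewrite -scaleN1r cmulDr cmulZr scaleN1r. Qed.

Lemma cmul0l x : 0 ** x = 0 :> A.
Proof. by rewrite -{1}(subrr x) cmulBl subrr. Qed.

Lemma cmul0r x : x ** 0 = 0 :> A.
Proof. by rewrite -{1}(subrr x) cmulBr subrr. Qed.

Lemma starZr r x : star (r%:C%C *: x) = r%:C%C *: star x.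
Proof. by rewrite starZ; congr (_ *: _); rewrite /conjc /= oppr0. Qed.

Lemma starN x : star (- x) = - star x.
Proof. by have := starZr (-1) x; rewrite rmorphN1 !scaleN1r. Qed.

Lemma starB x y : star (x - y) = star x - star y.
Proof. by rewrite starD starN. Qed.

Lemma nm_cmul x y : nm (x ** y) <= nm x * nm y.
Proof. by rewrite -lecR rmorphM /= -!nmE norm_cmul. Qed.

Lemma nm_star_cmul x : nm (star x ** x) = nm x ^+ 2.
Proof. by apply: complexI; rewrite -nmE norm_star_cmul nmE rmorphXn. Qed.

Lemma nm_star x : nm (star x) = nm x.
Proof.
suff le y : nm y <= nm (star y).
  by apply/eqP; rewrite eq_le le andbT -{2}[x]starK le.
have [/eqP y0|y0] := boolP (nm y == 0); first by rewrite y0 nm_ge0.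
have yp : 0 < nm y by rewrite lt_neqAle eq_sym y0 nm_ge0.
by rewrite -(ler_pM2r yp) -expr2 -nm_star_cmul nm_cmul.
Qed.

Lemma star_cmul_eq0 x : star x ** x = 0 -> x = 0.
Proof.
move=> h; apply: nm_eq0; apply/eqP.
by rewrite -sqrf_eq0 -nm_star_cmul h nm0.
Qed.

Lemma cvg_cmull c (u : nat -> A) l :
  u n @[n --> \oo] --> l -> c ** u n @[n --> \oo] --> c ** l.
Proof.
move=> /nm_cvg ul; apply/nm_cvg => e e0.
have c0 : 0 < nm c + 1 by have := nm_ge0 c; lra.
have [N hN] := ul (e / (nm c + 1)) (divr_gt0 e0 c0).
exists N => n /hN h; rewrite -cmulBr.
apply: le_lt_trans (nm_cmul _ _) _; rewrite ltr_pdivlMr // in h.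
apply: le_lt_trans _ h; rewrite mulrC ler_wpM2l ?nm_ge0 //; lra.
Qed.

Lemma cvg_star (u : nat -> A) l :
  u n @[n --> \oo] --> l -> star (u n) @[n --> \oo] --> star l.
Proof.
move=> /nm_cvg ul; apply/nm_cvg => e /ul [N hN].
by exists N => n /hN; rewrite -starB nm_star.
Qed.

Lemma cvg_cmulr c (u : nat -> A) l :
  u n @[n --> \oo] --> l -> u n ** c @[n --> \oo] --> l ** c.
Proof.
move=> /cvg_star /(@cvg_cmull (star c)) /cvg_star.
by under eq_fun do rewrite starM !starK; rewrite starM !starK.
Qed.

(* Self-adjoint operators on [A], seen as a right Hilbert module over itself;
   their linearity is automatic. *)
Definition saop T := forall x y, star (T x) ** y = star x ** T y.
Definition bdd T r := forall x, nm (T x) <= r * nm x.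

(** Take [x = y - z] and use the C*-identity. This nondegeneracy of the [A]-valued inner product is
    what makes self-adjointness force linearity. *)
Lemma star_cmul_inj y z : (forall x, star x ** y = star x ** z) -> y = z.
Proof.
move=> h; apply/eqP; rewrite -subr_eq0; apply/eqP/star_cmul_eq0.
by rewrite cmulBr h subrr.
Qed.

Lemma saopD T : saop T -> {morph T : x y / x + y}.
Proof.
by move=> sT x y; apply: star_cmul_inj => z; rewrite -sT !cmulDr !sT.
Qed.

Lemma saopZ T c : saop T -> {morph T : x / c *: x}.
Proof.
by move=> sT x; apply: star_cmul_inj => z; rewrite -sT !cmulZr !sT.
Qed.

Lemma saopB T : saop T -> {morph T : x y / x - y}.
Proof. by move=> sT x y; rewrite saopD // -scaleN1r saopZ // scaleN1r. Qed.

Lemma saop_mulr T x y : saop T -> T (x ** y) = T x ** y.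
Proof.
by move=> sT; apply: star_cmul_inj => z; rewrite -sT !cmulA sT.
Qed.

Lemma saop_cmul b : star b = b -> saop (cmul b).
Proof. by move=> sb x y; rewrite starM sb cmulA. Qed.

Lemma saop_scale r : saop (fun x => r%:C%C *: x).
Proof. by move=> x y; rewrite starZr cmulZl cmulZr. Qed.

Lemma saop_sub T N : saop T -> saop N -> saop (fun x => T x - N x).
Proof. by move=> sT sN x y; rewrite starB cmulBl sT sN cmulBr. Qed.

Lemma saop_comp T N : saop T -> saop N -> (forall x, T (N x) = N (T x)) ->
  saop (fun x => T (N x)).
Proof. by move=> sT sN c x y; rewrite sT sN c. Qed.

Lemma saop_id : saop id. Proof. by []. Qed.

(* [T] is the real part of [T + iN], and [|(T + iN) x|^2 = x^*(T^2 + N^2) x]. *)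
Lemma saop_sq_bound T N x r : saop T -> saop N -> T (N x) = N (T x) ->
  0 <= r -> nm (star x ** (T (T x) + N (N x))) <= r ^+ 2 -> nm (T x) <= r.
Proof.
move=> sT sN TN r0 h.
have key (c : R[i]) : conjc c = - c -> c * c = -1 -> nm (T x + c *: N x) <= r.
  move=> cc c2; rewrite -(@ler_pXn2r _ 2) ?nnegrE ?nm_ge0 // -nm_star_cmul.
  rewrite starD starZ cc cmulDl !cmulDr !cmulZl !cmulZr !sT !sN -TN.
  rewrite scalerA mulNr c2 opprK scale1r addrA -[_ + _ + - c *: _]addrA.
  by rewrite -scalerDl subrr scale0r addr0 -cmulDr.
have i2 : ('i%C * 'i%C = -1 :> R[i]) by rewrite -expr2 sqr_i.
have e1 := key 'i%C; have e2 := key (- 'i%C).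
have {}e1 : nm (T x + 'i%C *: N x) <= r.
  by apply: e1 => //; apply/eqP; rewrite eq_complex /= oppr0 !eqxx.
have {}e2 : nm (T x + (- 'i%C) *: N x) <= r.
  by apply: e2; rewrite ?mulrNN //; apply/eqP; rewrite eq_complex /= !opprK !oppr0 !eqxx.
have : nm (2%:C%C *: T x) <= r + r.
  apply: le_trans (lerD e1 e2); apply: le_trans (nmD _ _).
  rewrite addrACA -scalerDl subrr scale0r addr0 -{2 3}[T x]scale1r -scalerDl.
  by rewrite rmorphMn rmorph1.
rewrite nmZr ger0_norm //; lra.
Qed.

End CstarBasics.

Arguments cvg_cmull {R A} c {u l} _.
Arguments cvg_cmulr {R A} c {u l} _.
Arguments cvg_star {R A u l} _.

(** * Square roots *)

Section SquareRoot.
Variables (R : realType) (A : cstarAlgType R).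
Implicit Types (x y z a b : A) (r s : R) (T N X : A -> A).

(* Iterates for [S = 1 - sqrt (1 - X)], the solution of [2 S = X + S^2]. *)
Fixpoint sqrt_it X n x : A :=
  if n is m.+1 then (2^-1)%:C%C *: (X x + sqrt_it X m (sqrt_it X m x)) else 0.

(** This is the iteration of [sqrt_it] for the scalar [1]; it majorizes the operator iteration when
    [|X| <= 1]. *)
Fixpoint sqrt_bound n : R :=
  if n is m.+1 then (1 + sqrt_bound m ^+ 2) / 2 else 0.

Definition sqrt_op X x : A := lim (sqrt_it X n x @[n --> \oo]).

Lemma sqrt_boundP n :
  [/\ 0 <= sqrt_bound n, sqrt_bound n <= 1 & sqrt_bound n <= sqrt_bound n.+1].
Proof.
elim: n => [|n [h0 h1 h2]] /=; first by split; lra.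
split; [nra|nra|move: h2 => /=; nra].
Qed.

(** The gap [t] to the limit [1] evolves by [t - t^2 / 2]. Norm [1] is the critical case: the decay
    is of order [2 / n] and not geometric. *)
Lemma sqrt_bound_rate n : 1 - sqrt_bound n <= 2 / n.+2%:R.
Proof.
elim: n => [|n IH] /=; first by rewrite divff //; lra.
have [h0 h1 _] := sqrt_boundP n.
have n2 : 0 < n.+2%:R :> R by rewrite ltr0n.
have n3 : 0 < n.+3%:R :> R by rewrite ltr0n.
have -> : (1 - (1 + sqrt_bound n ^+ 2) / 2) =
  (1 - sqrt_bound n) - (1 - sqrt_bound n) ^+ 2 / 2 by field.
set t := 1 - sqrt_bound n in IH *.
set u := 2 / n.+2%:R in IH.
have u1 : u <= 1 by rewrite /u ler_pdivrMr // mul1r ler_nat.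
(* [t - t^2 / 2] increases for [t <= 1], so the inductive bound [u] may replace [t]. *)
apply: (@le_trans _ _ (u - u ^+ 2 / 2)); first by nra.
rewrite ler_pdivlMr // /u.
have -> : n.+3%:R = n.+2%:R + 1 :> R by rewrite -natr1.
set m := n.+2%:R in n2 *.
have m0 : m != 0 by rewrite gt_eqF.
have -> : (2 / m - (2 / m) ^+ 2 / 2) * (m + 1) = 2 - 2 / m ^+ 2 by field.
have : 0 < m ^+ 2 by rewrite exprn_gt0.
by move=> m2; rewrite gerBl divr_ge0 // ltW.
Qed.

Section Iterates.
Variable X : A -> A.
Hypotheses (sX : saop X) (bX : bdd X 1).

Lemma sqrt_it_comm n T : saop T -> (forall x, T (X x) = X (T x)) ->
  forall x, T (sqrt_it X n x) = sqrt_it X n (T x).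
Proof.
move=> sT c; elim: n => [|n IH] x /=.
  by rewrite -(scale0r (0 : A)) saopZ // !scale0r.
by rewrite saopZ // saopD // c !IH.
Qed.

Lemma sqrt_it_saop n : saop (sqrt_it X n).
Proof.
elim: n => [|n IH] x y /=.
  by rewrite -(subrr (0 : A)) starB cmulBl cmulBr !subrr.
rewrite starZr cmulZl cmulZr starD cmulDl cmulDr sX.
by congr (_ *: (_ + _)); rewrite IH IH.
Qed.

Lemma sqrt_it_commX n x : X (sqrt_it X n x) = sqrt_it X n (X x).
Proof. exact: sqrt_it_comm. Qed.

Lemma sqrt_it_commit m n x :
  sqrt_it X m (sqrt_it X n x) = sqrt_it X n (sqrt_it X m x).
Proof.
by apply: sqrt_it_comm => [|y]; [exact: sqrt_it_saop|rewrite sqrt_it_commX].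
Qed.

Lemma sqrt_it_bdd n : bdd (sqrt_it X n) (sqrt_bound n).
Proof.
elim: n => [|n IH] x /=; first by rewrite nm0 mul0r.
have [h0 _ _] := sqrt_boundP n.
rewrite nmZr ger0_norm ?invr_ge0 //.
have := nmD (X x) (sqrt_it X n (sqrt_it X n x)).
have := bX x; have := IH (sqrt_it X n x); have := ler_wpM2l h0 (IH x).
by rewrite mul1r; nra.
Qed.

(** The iterates commute, so the difference of two consecutive squares factors as sum times
    difference. The scalars [sqrt_bound] obey the same recursion with equality, and the resulting
    bounds telescope. *)
Lemma sqrt_it_step n x : nm (sqrt_it X n.+1 x - sqrt_it X n x) <=
  (sqrt_bound n.+1 - sqrt_bound n) * nm x.
Proof.
elim: n x => [|n IH] x.
  have -> : sqrt_it X 1 x = (2^-1)%:C%C *: (X x + 0) by [].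
  rewrite /= subr0 addr0 expr0n addr0 subr0 nmZr ger0_norm ?invr_ge0 //.
  by have := bX x; rewrite mul1r; lra.
set u := sqrt_it X n.+1 x - sqrt_it X n x.
have -> : sqrt_it X n.+2 x - sqrt_it X n.+1 x =
    (2^-1)%:C%C *: (sqrt_it X n.+1 u + sqrt_it X n u).
  have e k : sqrt_it X k.+1 x =
    (2^-1)%:C%C *: (X x + sqrt_it X k (sqrt_it X k x)) by [].
  rewrite (e n.+1) {2}(e n) -scalerBr; congr (_ *: _).
  rewrite !(saopB (@sqrt_it_saop _)).
  by rewrite (sqrt_it_commit n n.+1) opprD addrACA subrr add0r subrKA.
rewrite nmZr ger0_norm ?invr_ge0 //.
have := nmD (sqrt_it X n.+1 u) (sqrt_it X n u).
have := @sqrt_it_bdd n.+1 u; have := @sqrt_it_bdd n u; have := IH x.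
rewrite -/u.
have -> : sqrt_bound n.+2 = (1 + sqrt_bound n.+1 ^+ 2) / 2 by [].
have e : sqrt_bound n.+1 = (1 + sqrt_bound n ^+ 2) / 2 by [].
have [p0 _ _] := sqrt_boundP n; have [q0 _ _] := sqrt_boundP n.+1.
set p := sqrt_bound n in e p0 *; set q := sqrt_bound n.+1 in e q0 *.
move=> h1 h2 h3 h4.
have h : (q + p) * nm u <= (q + p) * ((q - p) * nm x).
  by rewrite ler_wpM2l ?addr_ge0.
have p2 : p ^+ 2 = 2 * q - 1 by rewrite e; field.
have -> : (1 + q ^+ 2) / 2 - q = (q + p) * (q - p) / 2.
  have -> : (q + p) * (q - p) = q ^+ 2 - p ^+ 2 by ring.
  by rewrite p2; field.
by lra.
Qed.

Lemma sqrt_it_cauchy m n x : (m <= n)%N ->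
  nm (sqrt_it X n x - sqrt_it X m x) <=
  (sqrt_bound n - sqrt_bound m) * nm x.
Proof.
elim: n => [|n IH]; first by rewrite leqn0 => /eqP ->; rewrite !subrr nm0 mul0r.
rewrite leq_eqVlt => /orP[/eqP ->|]; first by rewrite !subrr nm0 mul0r.
rewrite ltnS => /IH h; have := sqrt_it_step n x.
have := nm_triangle (sqrt_it X n x) (sqrt_it X n.+1 x) (sqrt_it X m x).
lra.
Qed.

Lemma sqrt_it_cvg x : sqrt_it X n x @[n --> \oo] --> sqrt_op X x.
Proof.
suff [l hl] : exists l : A, sqrt_it X n x @[n --> \oo] --> l.
  by rewrite /sqrt_op (cvg_lim _ hl).
apply: nm_cauchy => e e0.
have x1 : 0 < nm x + 1 by have := nm_ge0 x; lra.
have [N hN] : exists N : nat, 2 * (nm x + 1) / e < N%:R.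
  exists (Num.trunc (2 * (nm x + 1) / e)).+1.
  exact: truncnS_gt.
exists N; suff main m n : (N <= m)%N -> (m <= n)%N ->
    nm (sqrt_it X n x - sqrt_it X m x) < e.
  move=> m n Nm Nn; have [mn|/ltnW nm_] := leqP m n; last exact: main.
  by rewrite nmB; exact: main.
move=> Nm mn; apply: le_lt_trans (sqrt_it_cauchy x mn) _.
have := sqrt_bound_rate m; have [_ h1 _] := sqrt_boundP n.
have m2 : 0 < m.+2%:R :> R by rewrite ltr0n.
rewrite ler_pdivlMr // => h2.
have Nm' : N%:R <= m.+2%:R :> R by rewrite ler_nat (leq_trans Nm) // -addn2 leq_addr.
rewrite ltr_pdivrMr // in hN.
have := nm_ge0 x => x0.
set p := sqrt_bound n in h1 *; set q := sqrt_bound m in h2 *.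
set M := m.+2%:R in m2 h2 Nm'.
have h3 : 2 * (nm x + 1) < M * e by nra.
have h4 : (1 - q) * M * (nm x + 1) <= 2 * (nm x + 1) by rewrite ler_wpM2r // ltW.
have h5 : (1 - q) * (nm x + 1) < e by rewrite -(ltr_pM2l m2); nra.
have h6 : (p - q) * nm x <= (1 - q) * nm x by rewrite ler_wpM2r //; lra.
have [_ q1 _] := sqrt_boundP m; rewrite -/q in q1.
by nra.
Qed.

Lemma sqrt_op_saop : saop (sqrt_op X).
Proof.
move=> x y; have h1 := cvg_cmulr y (cvg_star (@sqrt_it_cvg x)).
have h2 := cvg_cmull (star x) (@sqrt_it_cvg y).
have e : (fun n => star (sqrt_it X n x) ** y) = (fun n => star x ** sqrt_it X n y).
  by apply/funext => n; rewrite sqrt_it_saop.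
by rewrite e in h1; exact: cvg_unique h1 h2.
Qed.

Lemma sqrt_op_bdd : bdd (sqrt_op X) 1.
Proof.
move=> x; apply: (nm_lim_le (@sqrt_it_cvg x)) => n; rewrite mul1r.
apply: le_trans (sqrt_it_bdd n x) _; have [_ h _] := sqrt_boundP n.
by rewrite ler_piMl ?nm_ge0.
Qed.

Lemma sqrt_op_cvg T (r : R) (u : nat -> A) l : saop T -> bdd T r ->
  u n @[n --> \oo] --> l -> T (u n) @[n --> \oo] --> T l.
Proof.
move=> sT bT /nm_cvg ul; apply/nm_cvg => e e0.
have r0 : 0 < `|r| + 1 by have := normr_ge0 r; lra.
have [N hN] := ul (e / (`|r| + 1)) (divr_gt0 e0 r0).
exists N => n /hN; rewrite ltr_pdivlMr // => h; rewrite -saopB //.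
apply: le_lt_trans (bT _) _; apply: le_lt_trans _ h; rewrite mulrC ler_wpM2l ?nm_ge0 //.
by have := ler_norm r; lra.
Qed.

Lemma sqrt_op_comm T (r : R) x : saop T -> bdd T r -> (forall x, T (X x) = X (T x)) ->
  T (sqrt_op X x) = sqrt_op X (T x).
Proof.
move=> sT bT c; have h1 := sqrt_op_cvg sT bT (@sqrt_it_cvg x).
have e : (fun n => T (sqrt_it X n x)) = (fun n => sqrt_it X n (T x)).
  by apply/funext => n; rewrite sqrt_it_comm.
by rewrite e in h1; apply: cvg_unique h1 (@sqrt_it_cvg _).
Qed.

(** This is the limit of the recursion. The composed iterates converge because each of them is
    contractive. *)
Lemma sqrt_opE x : sqrt_op X x + sqrt_op X x = X x + sqrt_op X (sqrt_op X x).
Proof.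
have h1 : sqrt_it X n (sqrt_it X n x) @[n --> \oo] --> sqrt_op X (sqrt_op X x).
  apply/nm_cvg => e e0; have e2 : 0 < e / 2 by lra.
  have /nm_cvg /(_ _ e2) [N1 h1] := @sqrt_it_cvg x.
  have /nm_cvg /(_ _ e2) [N2 h2] := @sqrt_it_cvg (sqrt_op X x).
  exists (maxn N1 N2) => n; rewrite geq_max => /andP[/h1 {}h1 /h2 {}h2].
  have := nm_triangle (sqrt_it X n (sqrt_op X x)) (sqrt_it X n (sqrt_it X n x))
    (sqrt_op X (sqrt_op X x)).
  rewrite -saopB; last exact: sqrt_it_saop.
  have := sqrt_it_bdd n (sqrt_it X n x - sqrt_op X x).
  have [h3 h4 _] := sqrt_boundP n; have := nm_ge0 (sqrt_it X n x - sqrt_op X x).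
  by nra.
have /nm_cvg h2 := @sqrt_it_cvg x.
move/nm_cvg: h1 => h1.
apply/eqP; rewrite -subr_eq0; apply/eqP; apply: nm_small => e e0.
have e4 : 0 < e / 4 by lra.
have [N1 {}h1] := h1 _ e4; have [N2 {}h2] := h2 _ e4.
set n := maxn N1 N2.
have {}h1 := h1 n (leq_maxl _ _).
have {}h2 := h2 n.+1 (leqW (leq_maxr _ _)).
set S := sqrt_op X in h1 h2 *; set u := sqrt_it X n (sqrt_it X n x) in h1.
set v := sqrt_it X n.+1 x in h2.
have vE : v + v = X x + u.
  rewrite /v /= -/u -scalerDl -rmorphD /=.
  have -> : (2^-1 + 2^-1 : R) = 1 by field.
  by rewrite scale1r.
have -> : S x + S x - (X x + S (S x)) = (S x - v) + (S x - v) + (u - S (S x)).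
  rewrite [S x - v + _]addrACA -opprD vE -[RHS]addrA [in RHS]opprD.
  by rewrite subrKA opprD.
have := nmD (S x - v + (S x - v)) (u - S (S x)).
have := nmD (S x - v) (S x - v); rewrite [nm (S x - v)]nmB.
by lra.
Qed.

Lemma sqrt_op_sq x : sqrt_op X x - sqrt_op X (sqrt_op X x) = X x - sqrt_op X x.
Proof.
apply/eqP; rewrite subr_eq addrAC eq_sym subr_eq eq_sym; apply/eqP.
exact: sqrt_opE.
Qed.

End Iterates.

(** Every iterate is built from [X], sums and real multiples, all compatible with [D], and [D] is
    closed under limits. In this way a square root is applied simultaneously to an element and to
    its twist. *)
Lemma sqrt_op_rel (D : A -> A -> Prop) X X' x x' :
  saop X -> bdd X 1 -> saop X' -> bdd X' 1 ->
  D 0 0 ->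
  (forall y y' z z', D y y' -> D z z' -> D (y + z) (y' + z')) ->
  (forall r y y', D y y' -> D (r%:C%C *: y) (r%:C%C *: y')) ->
  (forall u u' l l', (forall n, D (u n) (u' n)) ->
    u n @[n --> \oo] --> l -> u' n @[n --> \oo] --> l' -> D l l') ->
  (forall y y', D y y' -> D (X y) (X' y')) ->
  D x x' -> D (sqrt_op X x) (sqrt_op X' x').
Proof.
move=> sX bX sX' bX' D0 DD DZ Dl DX Dx.
apply: (Dl _ _ _ _ _ (@sqrt_it_cvg _ sX bX x) (@sqrt_it_cvg _ sX' bX' x')) => n.
elim: n x x' Dx => [|n IH] y y' Dy //=.
by apply: DZ; apply: DD; [exact: DX|apply/IH/IH].
Qed.

(* [rt X] is [sqrt (1 - X)]. *)
Definition rt X x : A := x - sqrt_op X x.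

Lemma rt_saop X : saop X -> bdd X 1 -> saop (rt X).
Proof. by move=> sX bX; exact: (saop_sub (@saop_id _ _) (sqrt_op_saop sX bX)). Qed.

Lemma rt_sq X x : saop X -> bdd X 1 -> rt X (rt X x) = x - X x.
Proof.
move=> sX bX; rewrite /rt (saopB (sqrt_op_saop sX bX)) sqrt_op_sq //.
by rewrite opprB addrA subrK.
Qed.

Lemma rt_comm X T (r : R) x : saop X -> bdd X 1 -> saop T -> bdd T r ->
  (forall x, T (X x) = X (T x)) -> T (rt X x) = rt X (T x).
Proof. by move=> sX bX sT bT c; rewrite /rt saopB // (sqrt_op_comm sX bX _ sT bT). Qed.

(* [K + i sqrt (1 - K^2)] is unitary. *)
Lemma saop_one_sub_sq K : saop K -> bdd K 1 -> bdd (fun x => x - K (K x)) 1.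
Proof.
move=> sK bK; set X := fun x => K (K x).
have sX : saop X by move=> x y; rewrite /X !sK.
have bX : bdd X 1.
  by move=> x; apply: le_trans (bK _) _; rewrite !mul1r -[nm x]mul1r; exact: bK.
have sN := rt_saop sX bX; have NN x := @rt_sq X x sX bX.
(* The squares of [rt X] and [K] add up to the identity, so [rt X] is contractive, and [1 - K^2] is
   its square. The triangle inequality alone would only give the bound [2]. *)
have bN : bdd (rt X) 1.
  move=> x; rewrite mul1r; apply: (saop_sq_bound sN sK) => //.
  - by rewrite (rt_comm x sX bX sK bK).
  - exact: nm_ge0.
  - by rewrite NN /X subrK nm_star_cmul.
move=> x; rewrite -[x - _]/(x - X x) -NN.
by apply: le_trans (bN _) _; rewrite !mul1r -[nm x]mul1r; exact: bN.
Qed.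

End SquareRoot.

(** * Comparing norms *)

Section Rigidity.
Variables (R : realType) (A : cstarAlgType R).
Implicit Types (x y z a b : A) (r s : R) (T N X : A -> A).

Lemma norm_le_of_closed_rel (D : A -> A -> Prop) b b' :
  D 0 0 ->
  (forall y y' z z', D y y' -> D z z' -> D (y + z) (y' + z')) ->
  (forall r y y', D y y' -> D (r%:C%C *: y) (r%:C%C *: y')) ->
  (forall u u' l l', (forall n, D (u n) (u' n)) ->
    u n @[n --> \oo] --> l -> u' n @[n --> \oo] --> l' -> D l l') ->
  (forall y y', D y y' -> D (b ** y) (b' ** y')) ->
  D b b' -> (forall y, D y 0 -> y = 0) ->
  star b = b -> star b' = b' -> nm b <= nm b'.
Proof.
move=> D0 DD DZ Dl Db Dbb' Dinj sb sb'; rewrite leNgt; apply/negP => lt.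
have bp : 0 < nm b by apply: le_lt_trans lt; exact: nm_ge0.
(* After scaling by [c], [b] has norm [1/2] and [b'] has norm [p < 1/2]. Then [s] is the midpoint of
   [p^2] and [1/4], and [K = H^2 - s] is a contraction for both elements. *)
pose c := (2 * nm b)^-1; have cp : 0 < c by rewrite invr_gt0 mulr_gt0.
have cb : c * nm b = 2^-1 by rewrite /c; field; rewrite gt_eqF.
pose p := c * nm b'; have p0 : 0 <= p by rewrite mulr_ge0 ?nm_ge0 // ltW.
have p2 : p < 2^-1 by rewrite -cb ltr_pM2l.
pose s := (p ^+ 2 + 4^-1) / 2.
have ps : p ^+ 2 < s by rewrite /s; nra.
have s4 : s < 4^-1 by rewrite /s; nra.
have s0 : 0 < s by rewrite /s; nra.
pose H d x := c%:C%C *: (d ** x) : A.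
have HE d x : H d x = c%:C%C *: (d ** x) by [].
have sH d : star d = d -> saop (H d).
  by move=> sd; apply: saop_comp (saop_scale c) (saop_cmul sd) _ => x; rewrite cmulZr.
have bH d : bdd (H d) (c * nm d).
  move=> x; rewrite HE nmZr gtr0_norm // -mulrA ler_wpM2l ?nm_cmul //; exact: ltW.
pose K d x := H d (H d x) - s%:C%C *: x.
have sK d : star d = d -> saop (K d).
  move=> sd; apply: saop_sub (saop_scale s).
  by apply: saop_comp (sH _ sd) (sH _ sd) _.
have bK d : c * nm d <= 2^-1 -> bdd (K d) 1.
  move=> hd x; have q0 : 0 <= c * nm d by rewrite mulr_ge0 ?nm_ge0 // ltW.
  have := nmD (H d (H d x)) (- (s%:C%C *: x)); rewrite nmN [nm (s%:C%C *: x)]nmZr gtr0_norm //.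
  have := bH d (H d x); have := ler_wpM2l q0 (bH d x); have := nm_ge0 x.
  rewrite mulrA -expr2 -/(K d x) => h1 h2 h3 h4.
  have q4 : (c * nm d) ^+ 2 <= 4^-1 by nra.
  by have := ler_wpM2r h1 q4; have := ler_wpM2r h1 (ltW s4); lra.
pose X d x := x - K d (K d x).
have sX d : star d = d -> saop (X d).
  by move=> /sK sd; apply: saop_sub (@saop_id _ _) _; apply: saop_comp.
have bX d : star d = d -> c * nm d <= 2^-1 -> bdd (X d) 1.
  by move=> sd hd; apply: saop_one_sub_sq; [exact: sK|exact: bK].
have HB d x y : H d (x - y) = H d x - H d y by rewrite !HE cmulBr scalerBr.
have HZ d r x : H d (r%:C%C *: x) = r%:C%C *: H d x.
  by rewrite !HE cmulZr scalerA mulrC -scalerA.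
clearbody H.
have HK d x : H d (K d x) = K d (H d x).
  by rewrite /K HB HZ.
have cHX d x : H d (X d x) = X d (H d x).
  by rewrite /X HB !HK.
(* As [X = 1 - K^2], [rt X] is the absolute value [|K|], so [Y] is [|K| + K]. *)
pose Y d x := rt (X d) x + K d x.
have cb2 : c * nm b <= 2^-1 by rewrite cb.
have cb2' : c * nm b' <= 2^-1 by rewrite ltW.
(* The squares of [|K|] and [K] agree, so [|K| - K] kills [w]. Writing [|K| = 1 - S], this reads
   [(1 + s) w = S w + H^2 w]; the right side has norm at most [(1 + p^2) |w|], and [p^2 < s] forces
   [w = 0]. *)
have Y'0 x : Y b' x = 0.
  set w := Y b' x; have sx := sX b' sb'; have bx := bX b' sb' cb2'.
  have KX y : K b' (X b' y) = X b' (K b' y) by rewrite /X saopB //; exact: sK.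
  have : rt (X b') w - K b' w = 0.
    rewrite /w /Y (saopD (rt_saop sx bx)) (saopD (sK _ sb')) rt_sq //.
    rewrite (rt_comm x sx bx (sK _ sb') (bK _ cb2') KX) /X.
    by rewrite opprB subrKC [X in _ - X]addrC subrr.
  rewrite /rt /K opprB => e.
  have e2 : (1 + s)%:C%C *: w = sqrt_op (X b') w + H b' (H b' w).
    rewrite rmorphD rmorph1 scalerDl scale1r; apply/eqP; rewrite -subr_eq0.
    by rewrite opprD addrACA e.
  apply: nm_eq0; have := congr1 (@nm _ _) e2.
  have := nmD (sqrt_op (X b') w) (H b' (H b' w)).
  have := sqrt_op_bdd sx bx w; have := bH b' (H b' w).
  have := ler_wpM2l p0 (bH b' w); rewrite -/p nmZr gtr0_norm; last lra.
  by have := nm_ge0 w; nra.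
(* The pair [(b, b')] lies in [D], and [Y] is assembled from operations that preserve [D]. *)
have Yb0 : Y b b = 0.
  apply: Dinj; rewrite -(Y'0 b'); rewrite /Y /rt.
  have DN y y' : D y y' -> D (- y) (- y').
    by move=> /(DZ (-1)); rewrite rmorphN1 !scaleN1r.
  have DH y y' : D y y' -> D (H b y) (H b' y') by rewrite !HE => /Db; exact: DZ.
  have DK y y' : D y y' -> D (K b y) (K b' y').
    by move=> h; apply: DD; [exact/DH/DH|apply/DN/DZ].
  apply: (DD); last exact: DK.
  apply: (DD) => //; apply: (DN); apply: sqrt_op_rel => //;
    [exact: sX|exact: bX|exact: sX|exact: bX|].
  by move=> y y' h; apply: DD => //; apply/DN/DK/DK.
have sx := sX b sb; have bx := bX b sb cb2.
have sS := sqrt_op_saop sx bx; have bS := sqrt_op_bdd sx bx.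
have HS x : H b (sqrt_op (X b) x) = sqrt_op (X b) (H b x).
  by apply: (sqrt_op_comm sx bx _ (sH _ sb) (bH b)).
(* [Y b b = 0] says that [H^2 + (1 - S)] multiplies the vector [b] by [s]. With [N] the square root
   of [1 - S] this bounds [|H b|], which equals [|b| / 2]; hence [1/4 <= s], a contradiction. *)
have le : nm (H b b) <= Num.sqrt s * nm b.
  apply: (saop_sq_bound (sH _ sb) (rt_saop sS bS)).
  - by apply: (rt_comm _ sS bS (sH _ sb) (bH b)).
  - by rewrite mulr_ge0 ?sqrtr_ge0 ?nm_ge0.
  - rewrite rt_sq //.
    have -> : H b (H b b) + (b - sqrt_op (X b) b) = s%:C%C *: b.
      have := Yb0; rewrite /Y /rt /K addrA => /eqP; rewrite subr_eq0 => /eqP <-.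
      by rewrite addrC.
    rewrite cmulZr nmZr gtr0_norm // nm_star_cmul exprMn sqr_sqrtr //; exact: ltW.
have : nm (H b b) = nm b / 2.
  by rewrite HE nmZr gtr0_norm // -{1}sb nm_star_cmul expr2 mulrA cb mulrC.
move=> e; rewrite e mulrC ler_pM2r // in le.
have : 2^-1 ^+ 2 <= s.
  by rewrite -(sqr_sqrtr (ltW s0)) ler_pXn2r // ?nnegrE ?sqrtr_ge0 // invr_ge0.
have -> : 2^-1 ^+ 2 = 4^-1 :> R by field.
by move=> /le_lt_trans /(_ s4); rewrite ltxx.
Qed.

Lemma cmul_inj_r y z : (forall x, y ** x = z ** x) -> y = z.
Proof.
move=> h; rewrite -[y]starK -[z]starK; congr star; apply: star_cmul_inj => x.
by rewrite -!starM h.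
Qed.

(* If [b] is self-adjoint with [|b| <= 1] and [y = (1 - sqrt (1 - b^2)) b] then
   [(b - y)^2 + b^4 = b^2], a relation preserved by [phi]. *)
Lemma star_hom_contractive (phi : A -> A) :
  linear phi -> {morph phi : a b / a ** b} -> {morph phi : a / star a} ->
  forall a, nm (phi a) <= nm a.
Proof.
move=> lphi pM pS.
have pD x y : phi (x + y) = phi x + phi y by have := lphi 1 x y; rewrite !scale1r.
have p0 : phi 0 = 0 by apply: (@addrI _ (phi 0)); rewrite -pD !addr0.
have pZ c x : phi (c *: x) = c *: phi x by have := lphi c x 0; rewrite p0 !addr0.
have unit b : star b = b -> nm b <= 1 -> nm (phi b) <= 1.
  move=> sb b1; set X := cmul (b ** b).
  have sX : saop X by apply: saop_cmul; rewrite starM !sb.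
  have bX : bdd X 1.
    move=> x; apply: le_trans (nm_cmul _ _) _; rewrite ler_wpM2r ?nm_ge0 //.
    by apply: le_trans (nm_cmul _ _) _; rewrite mulr_ile1 ?nm_ge0.
  have sS := sqrt_op_saop sX bX.
  set S := sqrt_op X in sS; set y := S b.
  have bS x : b ** S x = S (b ** x).
    apply: (sqrt_op_comm sX bX x (saop_cmul sb) (r := nm b)) => z.
      exact: nm_cmul.
    by rewrite /X !cmulA.
  have sy : star y = y.
    by apply: cmul_inj_r => z; rewrite /y sS sb bS saop_mulr.
  have yb : S (b ** b) = y ** b by rewrite saop_mulr.
  have by_ : b ** y = y ** b by rewrite -yb -bS.
  have e : y ** b + y ** b = b ** b ** (b ** b) + y ** y.
    have := sqrt_opE sX bX (b ** b); rewrite -/S yb => ->; congr (_ + _).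
    by rewrite -by_ saop_mulr.
  set b' := phi b; set y' := phi y.
  have sb' : star b' = b' by rewrite -pS sb.
  have sy' : star y' = y' by rewrite -pS sy.
  have by' : b' ** y' = y' ** b' by rewrite -!pM by_.
  have e' : y' ** b' + y' ** b' = b' ** b' ** (b' ** b') + y' ** y'.
    by rewrite -!pM -!pD e.
  (* For [T = b'^2] and [N = b' - y'] the sum [T^2 + N^2] is [b'^2]. *)
  have key x : nm (b' ** b' ** x) <= nm (b' ** x).
    apply: (@saop_sq_bound _ _ (cmul (b' ** b')) (cmul (b' - y'))).
    - by apply: saop_cmul; rewrite starM sb'.
    - by apply: saop_cmul; rewrite starB sb' sy'.
    - rewrite !cmulA; congr (_ ** _); rewrite cmulBr !cmulBl; congr (_ - _).
      by rewrite -cmulA by' cmulA by'.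
    - exact: nm_ge0.
    have -> : b' ** b' ** (b' ** b' ** x) + (b' - y') ** ((b' - y') ** x) = b' ** (b' ** x).
      rewrite !cmulA -!cmulDl; congr (_ ** _).
      have {1}-> : b' ** b' ** b' ** b' = y' ** b' + y' ** b' - y' ** y'.
        by rewrite e' addrK cmulA.
      rewrite cmulBr !cmulBl by'.
      set u := y' ** b'; set v := y' ** y'; set w := b' ** b'.
      by rewrite -[w - u - _]addrA -opprD [u + (u - v)]addrA [LHS]addrC subrK.
    by rewrite cmulA -{1}sb' -starM nm_star_cmul.
  have nb : nm (b' ** b') = nm b' ^+ 2 by rewrite -{1}sb' nm_star_cmul.
  have nb4 : nm (b' ** b' ** (b' ** b')) = nm b' ^+ 4.
    by rewrite -{1}[b' ** b']starK starM sb' nm_star_cmul nb -exprM.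
  (* The two instances chain to [t^4 <= |b'^3| <= t^2], so [t <= 1]. *)
  have := key (b' ** b'); have := key b'; rewrite [b' ** (b' ** b')]cmulA nb nb4 => h1 h2.
  have := le_trans h2 h1; have := nm_ge0 b'; set t := nm b' => t0 h.
  rewrite leNgt; apply/negP => t1; have t2 : 1 < t ^+ 2 by rewrite expr_gt1.
  have : t ^+ 4 = t ^+ 2 * t ^+ 2 by rewrite -exprD.
  by nra.
have sa b : star b = b -> nm (phi b) <= nm b.
  move=> sb; have [/eqP /nm_eq0 ->|b0] := boolP (nm b == 0); first by rewrite p0 nm0.
  have bp : 0 < nm b by rewrite lt_neqAle eq_sym b0 nm_ge0.
  have := unit ((nm b)^-1%:C%C *: b); rewrite starZr sb pZ !nmZr.
  rewrite gtr0_norm ?invr_gt0 // mulVf // => /(_ erefl (lexx _)).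
  by rewrite mulrC ler_pdivrMr // mul1r.
move=> a; rewrite -(@ler_pXn2r _ 2) ?nnegrE ?nm_ge0 // -!nm_star_cmul -pS -pM.
by apply: sa; rewrite starM starK.
Qed.

End Rigidity.

(** * Characters of a discrete abelian group *)

Section Characters.
Variables (R : realType) (G : zmodType).
Implicit Types (g h : G) (z w : R[i]) (F : set (G * R[i])).

(* Graphs of characters of subgroups of [G]. *)
Definition pchar F : Prop :=
  [/\ F (0, 1),
      forall g h z w, F (g, z) -> F (h, w) -> F (g - h, z / w),
      forall g z, F (g, z) -> `|z| = 1
    & forall z, F (0, z) -> z = 1].

Lemma unit_neq0 z : `|z| = 1 -> z != 0.
Proof. by move=> h; rewrite -normr_eq0 h oner_eq0. Qed.

Lemma pcharN F g z : pchar F -> F (g, z) -> F (- g, z^-1).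
Proof. by move=> [F0 FB _ _] /(FB _ _ _ _ F0); rewrite sub0r div1r. Qed.

Lemma pcharD F g h z w : pchar F -> F (g, z) -> F (h, w) -> F (g + h, z * w).
Proof.
move=> pF Fg /(pcharN pF) Fh; have [_ FB _ _] := pF.
by have := FB _ _ _ _ Fg Fh; rewrite opprK invrK.
Qed.

Lemma pchar_inj F g z w : pchar F -> F (g, z) -> F (g, w) -> z = w.
Proof.
move=> [_ FB Fn F1] Fz Fw; have /F1 : F (0, z / w).
  by rewrite -(subrr g); exact: FB.
by move=> /divr1_eq.
Qed.

Lemma pcharMn F g z n : pchar F -> F (g, z) -> F (g *+ n, z ^+ n).
Proof.
move=> pF Fg; elim: n => [|n IH]; first by rewrite mulr0n expr0; case: pF.
by rewrite mulrSr exprSr; exact: pcharD.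
Qed.

Lemma pcharMz F g z (k : int) : pchar F -> F (g, z) -> F (g *~ k, z ^ k).
Proof.
move=> pF Fg; case: k => n; first exact: pcharMn.
exact: (pcharN pF (pcharMn n.+1 pF Fg)).
Qed.

Definition pchar_adjoin F g w : set (G * R[i]) :=
  [set p | exists k : int, exists h z, F (h, z) /\ p = (h + g *~ k, z * w ^ k)].

(** Compatibility is what gives single-valuedness at [0]: if [h + g *~ k = 0], then [g *~ k = - h]
    carries the value [z^-1], which must be [w ^ k]. *)
Lemma pchar_adjoinP F g w : pchar F -> `|w| = 1 ->
  (forall (k : int) z, F (g *~ k, z) -> w ^ k = z) ->
  [/\ pchar (pchar_adjoin F g w), F `<=` pchar_adjoin F g w
    & pchar_adjoin F g w (g, w)].
Proof.
move=> pF w1 c; have w0 := unit_neq0 w1; have [F0 FB Fn F1] := pF.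
split.
- split.
  + by exists 0, 0, 1; split => //; rewrite mulr0z addr0 expr0z mulr1.
  + move=> _ _ _ _ [k [h [z [Fh [-> ->]]]]] [k' [h' [z' [Fh' [-> ->]]]]].
    exists (k - k'), (h - h'), (z / z'); split; first exact: FB.
    by rewrite mulrzBr opprD addrACA expfzDr // -invr_expz invfM mulrACA.
  + move=> g' z' [k [h [z [/Fn zn [_ ->]]]]]; rewrite normrM zn mul1r.
    case: k => n; first by rewrite -exprnP normrX w1 expr1n.
    by rewrite NegzE -invr_expz normfV -exprnP normrX w1 expr1n invr1.
  + move=> _ [k [h [z [Fh [/esym/eqP e ->]]]]].
    have hz := unit_neq0 (Fn _ _ Fh).
    rewrite addrC addr_eq0 in e; move/eqP: e => e.
    have := c k z^-1; rewrite e => -> ; first by rewrite mulfV.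
    exact: pcharN.
- by move=> [h z] Fh; exists 0, h, z; rewrite mulr0z addr0 expr0z mulr1.
- by exists 1, 0, 1; split => //; rewrite mulr1z add0r expr1z mul1r.
Qed.

Lemma norm_root w n : (0 < n)%N -> `|w ^+ n| = 1 -> `|w| = 1.
Proof. by move=> n0 /eqP; rewrite normrX pexpr_eq1 // => /eqP. Qed.

(** A subgroup of the integers is trivial or generated by its least positive element, by division
    with remainder. It is applied to the multiples of [g] lying in a given subgroup. *)
Lemma least_multiple (P : int -> Prop) :
  P 0 -> (forall k l, P k -> P l -> P (k - l)) ->
  (forall k, P k -> k = 0) \/
  exists2 n : nat, (0 < n)%N & P n%:Z /\ forall k, P k -> exists q : int, k = n%:Z * q.
Proof.
move=> P0 PB.
have PN k : P k -> P (- k) by move=> /(PB _ _ P0); rewrite sub0r.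
have [ex|nex] := pselect (exists n, (0 < n)%N && `[< P n%:Z >]); last first.
  left; move=> k Pk; apply/eqP; apply/negPn/negP => k0; apply: nex.
  exists `|k|%N; rewrite absz_gt0 k0; apply/asboolP.
  by case: (k) Pk => n // /PN; rewrite NegzE opprK.
right; case: (ex_minnP ex) => n /andP[n0 /asboolP Pn] min.
exists n => //; split => // k Pk; exists (k %/ n%:Z)%Z.
have PM (q : nat) : P (n%:Z * q%:Z).
  elim: q => [|q IH]; first by rewrite mulr0.
  have -> : n%:Z * q.+1%:Z = n%:Z * q%:Z - - n%:Z by rewrite opprK intS mulrDr mulr1 addrC.
  by apply: PB => //; exact: PN.
have PMz (q : int) : P (n%:Z * q).
  by case: q => q; [exact: PM|rewrite NegzE mulrN; apply/PN/PM].
have : P (k %% n%:Z)%Z.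
  have -> : (k %% n)%Z = k - n%:Z * (k %/ n)%Z by rewrite {2}(divz_eq k n) mulrC addrC addKr.
  exact: PB.
have n0' : n%:Z != 0 by rewrite eqz_nat -lt0n.
have [r re] : exists r : nat, (k %% n%:Z)%Z = r%:Z.
  by have := modz_ge0 k n0'; case: (k %% n%:Z)%Z => // r _; exists r.
have := ltz_pmod k (n0 : 0 < n%:Z); rewrite re ltz_nat => rn Pr.
rewrite {1}(divz_eq k n%:Z) re; suff -> : r = 0%N by rewrite addr0 mulrC.
apply/eqP; rewrite -leqn0 leqNgt; apply/negP => r0.
by have := min r; rewrite r0 (introT (asboolP _) Pr) => /(_ erefl); rewrite leqNgt rn.
Qed.

(** The circle is divisible: if the multiples of [g] in the domain are those of [g *+ n], an [n]-th
    root of the value there works. If only [0] occurs, any unit number does. *)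
Lemma pchar_compat F g : pchar F -> exists2 w,
  `|w| = 1 & forall (k : int) z, F (g *~ k, z) -> w ^ k = z.
Proof.
move=> pF; have [F0 FB Fn F1] := pF.
have [||triv|[n n0 [[z Fz] div]]] := @least_multiple (fun k => exists z, F (g *~ k, z)).
- by exists 1; rewrite mulr0z.
- by move=> k l [z Fz] [w Fw]; exists (z / w); rewrite mulrzBr; exact: FB.
- exists 1; first exact: normr1.
  move=> k z Fz; rewrite exp1rz; apply/esym/F1.
  by rewrite -(mulr0z g) -(triv k) //; exists z.
pose w := n.-root z; have wn : w ^+ n = z by rewrite rootCK.
exists w; first by apply: (norm_root n0); rewrite wn; exact: Fn Fz.
move=> k z' Fk; have [q e] := div k (ex_intro _ _ Fk).
apply: (pchar_inj pF _ Fk); rewrite e mulrzA -exprz_exp.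
by apply: pcharMz; rewrite // -exprnP wn.
Qed.

Lemma pchar_extend F0 : pchar F0 ->
  exists chi : dual R G, forall g z, F0 (g, z) -> chi g = z.
Proof.
move=> pF0; pose P F := F = set0 \/ (pchar F /\ F0 `<=` F).
have [C CP tot|M [PM max]] := @Zorn_bigcup _ P.
  have [[X CX XP]|none] := pselect (exists2 X, C X & pchar X /\ F0 `<=` X); last first.
    left; apply/seteqP; split => // x [X CX Xx]; apply: none.
    have [X0|XP] := CP X CX; last by exists X.
    by move: Xx; rewrite X0.
  right; have [pX F0X] := XP; have [X0 _ _ _] := pX.
  have big Y x : C Y -> Y x -> pchar Y.
    by move=> CY Yx; have [Y0|[]//] := CP Y CY; move: Yx; rewrite Y0.
  split; last by move=> x /F0X Xx; exists X.
  split; first by exists X.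
  - move=> g h z w [Y CY Yg] [Z CZ Zh].
    have [YZ|ZY] := tot Y Z CY CZ.
      by exists Z => //; have [_ ZB _ _] := big Z _ CZ Zh; apply: ZB => //; exact: YZ.
    by exists Y => //; have [_ YB _ _] := big Y _ CY Yg; apply: YB => //; exact: ZY.
  - by move=> g z [Y CY Yg]; have [_ _ Yn _] := big Y _ CY Yg; exact: Yn Yg.
  - by move=> z [Y CY Yg]; have [_ _ _ Y1] := big Y _ CY Yg; exact: Y1.
have {PM} [pM F0M] : pchar M /\ F0 `<=` M.
  case: PM => // M0; exfalso; apply: (max F0); last by right; split.
  rewrite M0; split; first by [].
  by move=> /(_ (0, 1)); have [h _ _ _] := pF0; apply.
have Mtot g : exists z, M (g, z).
  have [w w1 c] := pchar_compat g pM.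
  have [pM' MM' M'g] := pchar_adjoinP pM w1 c.
  exists w; apply: contrapT => nM; apply: (max (pchar_adjoin M g w)).
    by split => // /(_ _ M'g).
  by right; split => //; exact: subset_trans MM'.
pose f g := projT1 (cid (Mtot g)); have fP g : M (g, f g) := projT2 (cid (Mtot g)).
have [_ _ Mn _] := pM.
have fn g : `|f g| = 1 by exact: Mn (fP g).
have fD g h : f (g + h) = f g * f h.
  by apply: (pchar_inj pM (fP _)); exact: pcharD.
exists (Character fn fD) => g z /F0M; exact: pchar_inj (fP g).
Qed.

Lemma nontrivial_unity_root n : (1 < n)%N -> exists2 w : R[i], w ^+ n = 1 & w != 1.
Proof.
(* A root of [1 + X + ... + X^(n-1)] is an [n]-th root of unity, and [1] is not a root, the value
   there being [n]. *)
move=> n1; pose p : {poly R[i]} := \poly_(i < n) 1.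
have sp : size p = n by rewrite size_poly_eq // oner_eq0.
have /closed_rootP [w] : size p != 1%N by rewrite sp neq_ltn n1 orbT.
rewrite rootE horner_poly => /eqP pw; exists w.
  apply/eqP; rewrite -subr_eq0 subrX1; apply/eqP.
  rewrite -[RHS](mulr0 (w - 1)) -[X in _ = _ * X]pw; congr (_ * _).
  by apply: eq_bigr => i _; rewrite mul1r.
apply/eqP => w1; move: pw; rewrite w1.
under eq_bigr do rewrite expr1n mulr1.
by rewrite sumr_const card_ord => /eqP; rewrite pnatr_eq0 => /eqP n0; rewrite n0 in n1.
Qed.

(** The trivial character of [{0}] is extended to the group generated by [g], with value [-1] at [g]
    if [g] has infinite order and a nontrivial root of unity of that order otherwise, and then to
    [G]. *)
Lemma dual_separates g : g != 0 -> exists chi : dual R G, chi g != 1.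
Proof.
move=> g0; pose T : set (G * R[i]) := [set (0, 1)].
have pT : pchar T.
  split => //; last by move=> z [].
    by move=> ? ? ? ? [-> ->] [-> ->]; rewrite /T /= subrr divr1.
  by move=> ? ? [_ ->]; exact: normr1.
have [w wn [w1 c]] : exists2 w : R[i], `|w| = 1 &
    w != 1 /\ forall (k : int) z, T (g *~ k, z) -> w ^ k = z.
  have [||triv|[n n0 [gn div]]] := @least_multiple (fun k => g *~ k = 0).
  - by rewrite mulr0z.
  - by move=> k l gk gl; rewrite mulrzBr gk gl subrr.
  - exists (-1); first by rewrite normrN normr1.
    split; first by rewrite -subr_eq0 -opprD oppr_eq0 -mulr2n pnatr_eq0.
    by move=> k z [/triv -> ->]; rewrite expr0z.
  have n1 : (1 < n)%N.
    rewrite ltn_neqAle n0 andbT eq_sym; apply: contraNneq g0 => n1.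
    by move: gn; rewrite n1 mulr1z => ->.
  have [w wn w1] := nontrivial_unity_root n1.
  exists w; first by apply: (norm_root n0); rewrite wn normr1.
  by split => // k z [/div [q ->] ->]; rewrite -exprz_exp -exprnP wn exp1rz.
have [pT' _ Tg] := pchar_adjoinP pT wn c.
have [chi hchi] := pchar_extend pT'.
by exists chi; rewrite (hchi _ _ Tg).
Qed.

End Characters.

(** * Integrals of simple functions *)

Section SimpleIntegral.
Variables (R : realType) (d : measure_display) (X : measurableType d).
Variables (V : completeNormedModType R[i]) (mu : probability X R).

Definition mass (B : set X) : R := fine (mu B).

Lemma mass_ge0 B : 0 <= mass B.
Proof. by rewrite /mass fine_ge0. Qed.

Lemma mass0 : mass set0 = 0.
Proof. by rewrite /mass measure0. Qed.

Lemma massT : mass setT = 1.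
Proof. by rewrite /mass probability_setT. Qed.

Lemma massU B C : measurable B -> measurable C -> B `&` C = set0 ->
  mass (B `|` C) = mass B + mass C.
Proof.
move=> mB mC BC; rewrite /mass measureU // fineD //; exact: fin_num_measure.
Qed.

Section Labelling.
Variables (T : choiceType) (t : X -> T) (r : seq T).
Hypotheses (r_uniq : uniq r) (t_r : forall x, t x \in r).
Hypothesis mt : forall w, measurable (t @^-1` [set w]).

Lemma measurable_label (P : pred T) : measurable [set x | P (t x)].
Proof.
have -> : [set x | P (t x)] = \bigcup_(w in [set` [seq w <- r | P w]]) (t @^-1` [set w]).
  apply/seteqP; split => [x Px|x [w /=]].
    by exists (t x) => //=; rewrite mem_filter Px t_r.
  by rewrite mem_filter => /andP[Pw _] ->.
by apply: fin_bigcup_measurable => // w _; exact: mt.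
Qed.

Lemma mass_label (P : pred T) :
  mass [set x | P (t x)] = \sum_(w <- r | P w) mass (t @^-1` [set w]).
Proof.
have -> : [set x | P (t x)] = [set x | (t x \in r) && P (t x)].
  by apply/seteqP; split => x /=; rewrite t_r.
elim: r r_uniq => [_|w s IH /= /andP[ws us]].
  by rewrite big_nil -mass0; congr mass; apply/seteqP; split.
rewrite big_cons -IH //; case: ifP => Pw; last first.
  congr mass; apply/seteqP; split => x /=; rewrite inE.
    by case: eqP => [->|_] //=; rewrite Pw.
  by move=> /andP[-> ->]; rewrite orbT.
rewrite -massU; first last.
- apply/seteqP; split => // x [/= tw]; rewrite tw => /andP[h _].
  by rewrite h in ws.
- exact: (measurable_label (fun z => (z \in s) && P z)).
- exact: mt.
congr mass; apply/seteqP; split => x /=; rewrite inE.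
  by case: eqP => [tw _|_ /=]; [left|right].
by move=> [->|/andP[-> ->]]; rewrite ?eqxx ?Pw ?orbT.
Qed.

(** The level sets of the composite are unions of level sets of [t]. Summing over labels instead of
    values makes the integral visibly linear in [phi]. *)
Lemma simple_integralE (phi : T -> V) :
  simple_integral mu (phi \o t) =
  \sum_(w <- r) (mass (t @^-1` [set w]))%:C%C *: phi w.
Proof.
rewrite /simple_integral; pose r' := undup (map phi r).
rewrite (fsbig_widen (range (phi \o t)) [set` r']); first last.
- move=> v [_ /= nv]; rewrite -[fine _]/(mass _) (_ : _ @^-1` _ = set0) ?mass0 ?scale0r //.
  by apply/seteqP; split => // x /= e; apply: nv; exists x.
- by move=> _ [x _ <-] /=; rewrite mem_undup map_f.
rewrite -fsbig_seq ?undup_uniq //.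
transitivity (\sum_(v <- r') \sum_(w <- r | phi w == v)
    (mass (t @^-1` [set w]))%:C%C *: phi w).
  apply: eq_bigr => v _; rewrite -[fine _]/(mass _).
  have -> : (phi \o t) @^-1` [set v] = [set x | phi (t x) == v].
    by apply/seteqP; split => x /= /eqP.
  rewrite (mass_label (fun w => phi w == v)) rmorph_sum scaler_suml.
  by apply: eq_bigr => w /eqP ->.
rewrite (exchange_big_dep xpredT) //= big_seq [RHS]big_seq.
apply: eq_bigr => w wr; under eq_bigl do rewrite eq_sym.
rewrite -big_filter filter_pred1_uniq ?undup_uniq ?big_seq1 //.
by rewrite mem_undup map_f.
Qed.

Lemma simple_integral_le (phi : T -> V) (C : R) :
  (forall x, nm (phi (t x)) <= C) -> nm (simple_integral mu (phi \o t)) <= C.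
Proof.
move=> h; rewrite simple_integralE.
have -> : C = \sum_(w <- r) mass (t @^-1` [set w]) * C.
  rewrite -mulr_suml -(mass_label xpredT) [X in mass X](_ : _ = setT) ?massT ?mul1r //.
  by apply/seteqP; split.
have le w : nm ((mass (t @^-1` [set w]))%:C%C *: phi w) <= mass (t @^-1` [set w]) * C.
  rewrite nmZr ger0_norm ?mass_ge0 //.
  (* Nothing bounds [phi] at a label that is not attained, but such a label has mass [0]. *)
  have [[x tx]|none] := pselect (exists x, t x = w).
    by rewrite ler_wpM2l ?mass_ge0 // -tx.
  rewrite (_ : _ @^-1` _ = set0) ?mass0 ?mul0r //.
  by apply/seteqP; split => // x /= e; apply: none; exists x.
elim: r => [|w s IH]; first by rewrite !big_nil nm0.
by rewrite !big_cons; apply: le_trans (nmD _ _) _; exact: lerD.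
Qed.

End Labelling.

Definition simple (s : X -> V) : Prop :=
  finite_set (range s) /\ forall v, measurable (s @^-1` [set v]).

Lemma simple_label (T : choiceType) (t : X -> T) (r : seq T) (phi : T -> V) :
  (forall x, t x \in r) -> (forall w, measurable (t @^-1` [set w])) ->
  simple (phi \o t).
Proof.
move=> tr mt; split.
  apply: (@sub_finite_set _ _ [set` map phi r]) => // _ [x _ <-] /=.
  exact: map_f.
move=> v; have -> : (phi \o t) @^-1` [set v] = [set x | phi (t x) == v].
  by apply/seteqP; split => x /= /eqP.
exact: (measurable_label tr mt (fun w => phi w == v)).
Qed.

(** The pair of values labels a common refinement of the two partitions, so that both functions are
    projections composed with one labelling. *)
Lemma simple_pair s1 s2 : simple s1 -> simple s2 ->
  exists r : seq (V * V), [/\ uniq r, forall x, (s1 x, s2 x) \in r &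
    forall w, measurable ((fun x => (s1 x, s2 x)) @^-1` [set w])].
Proof.
move=> [f1 m1] [f2 m2].
have [r1 e1] := (finite_seqP _).1 f1; have [r2 e2] := (finite_seqP _).1 f2.
have mem1 x : s1 x \in r1 by have : [set` r1] (s1 x) by rewrite -e1; exists x.
have mem2 x : s2 x \in r2 by have : [set` r2] (s2 x) by rewrite -e2; exists x.
exists (undup [seq (v, w) | v <- r1, w <- r2]).
split; first exact: undup_uniq.
  by move=> x; rewrite mem_undup allpairs_f.
move=> [v w]; have -> : (fun x => (s1 x, s2 x)) @^-1` [set (v, w)] =
    s1 @^-1` [set v] `&` s2 @^-1` [set w].
  by apply/seteqP; split => x /= [-> ->].
exact: measurableI.
Qed.

Lemma simpleD s1 s2 : simple s1 -> simple s2 -> simple (fun x => s1 x + s2 x).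
Proof.
move=> h1 h2; have [r [ur mr mw]] := simple_pair h1 h2.
exact: (@simple_label _ (fun x => (s1 x, s2 x)) r (fun p => p.1 + p.2)).
Qed.

Lemma simpleZ (c : R[i]) s : simple s -> simple (fun x => c *: s x).
Proof.
move=> h; have [r [ur mr mw]] := simple_pair h h.
exact: (@simple_label _ (fun x => (s x, s x)) r (fun p => c *: p.1)).
Qed.

Lemma measurable_preimage_cst (v w : V) : measurable ((fun=> v : V) @^-1` [set w] : set X).
Proof.
have [->|/eqP vw] := eqVneq v w.
  by rewrite (_ : _ @^-1` _ = setT) //; apply/seteqP; split.
by rewrite (_ : _ @^-1` _ = set0) //; apply/seteqP; split.
Qed.

Lemma simple_cst v : simple (fun=> v).
Proof.
apply: (@simple_label _ (fun=> v) [:: v] id) => [x|w]; first by rewrite inE.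
exact: measurable_preimage_cst.
Qed.

Lemma simple_integralD s1 s2 : simple s1 -> simple s2 ->
  simple_integral mu (fun x => s1 x + s2 x) =
  simple_integral mu s1 + simple_integral mu s2.
Proof.
move=> h1 h2; have [r [ur mr mw]] := simple_pair h1 h2.
have e := simple_integralE ur mr mw.
rewrite -[LHS]/(simple_integral mu ((fun p => p.1 + p.2) \o (fun x => (s1 x, s2 x)))).
rewrite -[simple_integral mu s1]/(simple_integral mu (fst \o (fun x => (s1 x, s2 x)))).
rewrite -[simple_integral mu s2]/(simple_integral mu (snd \o (fun x => (s1 x, s2 x)))).
by rewrite !e -big_split; apply: eq_bigr => w _; rewrite scalerDr.
Qed.

Lemma simple_integralZ (c : R[i]) s : simple s ->
  simple_integral mu (fun x => c *: s x) = c *: simple_integral mu s.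
Proof.
move=> h; have [r [ur mr mw]] := simple_pair h h.
have e := simple_integralE ur mr mw.
rewrite -[LHS]/(simple_integral mu ((fun p => c *: p.1) \o (fun x => (s x, s x)))).
rewrite -[simple_integral mu s]/(simple_integral mu (fst \o (fun x => (s x, s x)))).
by rewrite !e scaler_sumr; apply: eq_bigr => w _; rewrite !scalerA mulrC.
Qed.

Lemma simple_integral_cst (v : V) : simple_integral mu (fun=> v) = v.
Proof.
have e := @simple_integralE V (fun=> v) [:: v] isT.
rewrite -[LHS]/(simple_integral mu ((id : V -> V) \o (fun=> v))) e => [|x|w].
- rewrite big_seq1 (_ : _ @^-1` _ = setT) ?massT ?scale1r //.
  by apply/seteqP; split.
- by rewrite inE.
- exact: measurable_preimage_cst.
Qed.

Lemma nm_simple_integral s (C : R) : simple s -> (forall x, nm (s x) <= C) ->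
  nm (simple_integral mu s) <= C.
Proof.
move=> h hC; have [r [ur mr mw]] := simple_pair h h.
exact: (simple_integral_le ur mr mw (phi := fst)).
Qed.

Lemma nm_simple_integralB s1 s2 (C : R) : simple s1 -> simple s2 ->
  (forall x, nm (s1 x - s2 x) <= C) ->
  nm (simple_integral mu s1 - simple_integral mu s2) <= C.
Proof.
move=> h1 h2 hC; have h3 := simpleZ (-1) h2.
rewrite -[_ - _](_ : simple_integral mu (fun x => s1 x + (-1) *: s2 x) = _); last first.
  by rewrite simple_integralD // simple_integralZ // scaleN1r.
apply: nm_simple_integral => [|x]; first exact: simpleD.
by rewrite scaleN1r.
Qed.

Lemma eq_simple_integral (s1 s2 : X -> V) :
  (forall v, mass (s1 @^-1` [set v]) = mass (s2 @^-1` [set v])) ->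
  range s1 = range s2 -> simple_integral mu s1 = simple_integral mu s2.
Proof.
move=> e er; rewrite /simple_integral er; apply: eq_fsbigr => v _.
by rewrite -[fine _]/(mass _) e.
Qed.

(** The total mass is [1], so a uniform error also bounds the integral of the error. Measurability
    of the distances to fixed vectors makes that error a measurable function. *)
Lemma bochner_of_uniform (f : X -> V) (v : V) :
  (forall w (c : R), measurable [set x | nm (f x - w) < c]) ->
  (forall e : R, 0 < e -> exists s : X -> V, [/\ simple s, forall x, nm (f x - s x) < e
    & nm (simple_integral mu s - v) < e]) ->
  is_bochner_integral mu f v.
Proof.
move=> mf h.
have n0 n : 0 < n.+1%:R^-1 :> R by rewrite invr_gt0 ltr0n.
pose s n := projT1 (cid (h _ (n0 n))).
have hs n : [/\ simple (s n), forall x, nm (f x - s n x) < n.+1%:R^-1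
    & nm (simple_integral mu (s n) - v) < n.+1%:R^-1] := projT2 (cid (h _ (n0 n))).
have ss n : s n \in fimfun by rewrite inE /=; have [[]] := hs n.
exists (fun n => fimfun_Sub (ss n)); split.
- by move=> n w; rewrite fimfun_valP; have [[_ +] _ _] := hs n; apply.
- apply: aeW => x; apply/nm_cvg => e /inv_succ_small[N hN]; exists N => n /hN hn.
  by rewrite fimfun_valP nmB; have [_ + _] := hs n => /(_ x) /lt_trans; apply.
(* On each of the finitely many level sets of [s n] the subtracted vector is constant. *)
- have mg n (c : R) : measurable [set x | nm (f x - s n x) < c].
    have [[fs ms] _ _] := hs n.
    have -> : [set x | nm (f x - s n x) < c] =
        \bigcup_(w in range (s n)) (s n @^-1` [set w] `&` [set x | nm (f x - w) < c]).
      apply/seteqP; split => [x hx|x [w _ [/= -> ]]] //.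
      by exists (s n x); [exists x|split].
    by apply: fin_bigcup_measurable => // w _; apply: measurableI.
  apply: (@squeeze_cvge _ _ _ _ (fun=> 0%E) _ (EFin \o harmonic)); first last.
  + exact: cvge_harmonic.
  + exact: cvg_cst.
  apply: nearW => n; apply/andP; split.
    by apply: integral_ge0 => x _; rewrite lee_fin nm_ge0.
  apply: (@le_trans _ _ (\int[mu]_x cst (n.+1%:R^-1)%:E x)%E); last first.
    by rewrite integral_cst // [X in (_ * X)%E]probability_setT mule1.
  apply: ge0_le_integral => //.
  + by move=> x _; rewrite lee_fin nm_ge0.
  + rewrite fimfun_valP; apply/measurable_EFinP.
    apply: (measurability _ (RGenInftyO.measurableE R)).
    by move=> _ [_ [c ->] <-]; rewrite setTI preimage_itvNyo; exact: mg.
  + by move=> x _; rewrite lee_fin fimfun_valP ltW //; have [_ + _] := hs n; apply.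
- apply/nm_cvg => e /inv_succ_small[N hN]; exists N => n /hN hn; rewrite fimfun_valP.
  by have [_ _ /lt_trans] := hs n; apply.
Qed.

End SimpleIntegral.

(** * The dual action *)

Section GradedAlgebra.
Variables (R : realType) (G : zmodType) (A : cstarAlgType R).
Variables (A_ : G -> set A) (E : A -> A).
Hypotheses (A_sub : forall g, linear_subspace (A_ g))
  (A_closed : forall g, closed (A_ g))
  (A_mul : forall g h a b, A_ g a -> A_ h b -> A_ (g + h) (a ** b))
  (A_star : forall g, star @` A_ g = A_ (- g))
  (A_dense : dense (algebraic_sum A_))
  (E_proj : extends_projection A_ E)
  (E_cond : conditional_expectation (A_ 0) E)
  (E_faithful : faithful E).
Implicit Types (g h : G) (x y z : A) (l m : seq (G * A)) (chi eta : dual R G).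

(* An element of the algebraic sum is presented by a list of homogeneous
   terms, degrees being allowed to repeat. *)
Definition gsum l : A := \sum_(p <- l) p.2.
Definition graded l : Prop := forall p, p \in l -> A_ p.1 p.2.
(** It acts on lists; that [gsum (twist chi l)] depends only on [gsum l] is a consequence of
    [twist_isometric]. *)
Definition twist chi l := [seq (p.1, chi p.1 *: p.2) | p <- l].

(** * Algebraic operations on lists of homogeneous terms *)

Lemma A_0 g : A_ g 0. Proof. by have [] := A_sub g. Qed.

Lemma A_Z g (c : R[i]) x : A_ g x -> A_ g (c *: x).
Proof. by have [h0 hD] := A_sub g; move=> Ax; rewrite -[_ *: _]addr0; exact: hD. Qed.

Lemma A_D g x y : A_ g x -> A_ g y -> A_ g (x + y).
Proof. by have [h0 hD] := A_sub g; move=> Ax Ay; rewrite -[x]scale1r; exact: hD. Qed.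

Lemma graded_nil : graded [::]. Proof. by []. Qed.

Lemma graded_cons p l : A_ p.1 p.2 -> graded l -> graded (p :: l).
Proof. by move=> hp hl q; rewrite inE => /orP[/eqP ->|/hl]. Qed.

Lemma graded_consP p l : graded (p :: l) -> A_ p.1 p.2 /\ graded l.
Proof. by move=> h; split => [|q ql]; apply: h; rewrite inE ?eqxx ?ql ?orbT. Qed.

Lemma graded_cat l m : graded l -> graded m -> graded (l ++ m).
Proof. by move=> hl hm p; rewrite mem_cat => /orP[/hl|/hm]. Qed.

Lemma graded_twist chi l : graded l -> graded (twist chi l).
Proof. by move=> hl _ /mapP[p /hl hp ->]; exact: A_Z. Qed.

Lemma gsum_nil : gsum [::] = 0. Proof. by rewrite /gsum big_nil. Qed.
Lemma gsum_cons p l : gsum (p :: l) = p.2 + gsum l.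
Proof. by rewrite /gsum big_cons. Qed.
Lemma gsum_cat l m : gsum (l ++ m) = gsum l + gsum m.
Proof. by rewrite /gsum big_cat. Qed.
Lemma twist_cat chi l m : twist chi (l ++ m) = twist chi l ++ twist chi m.
Proof. exact: map_cat. Qed.

Definition lscale (c : R[i]) l := [seq (p.1, c *: p.2) | p <- l].

Lemma graded_lscale c l : graded l -> graded (lscale c l).
Proof. by move=> hl _ /mapP[p /hl hp ->]; exact: A_Z. Qed.

Lemma gsum_lscale c l : gsum (lscale c l) = c *: gsum l.
Proof. by rewrite /gsum big_map scaler_sumr. Qed.

Lemma twist_lscale chi c l : twist chi (lscale c l) = lscale c (twist chi l).
Proof.
by rewrite /twist /lscale -!map_comp; apply: eq_map => p /=; rewrite !scalerA mulrC.
Qed.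

Lemma twist_mul chi eta l : twist (chi * eta)%g l = twist chi (twist eta l).
Proof.
by rewrite /twist -map_comp; apply: eq_map => p /=; rewrite scalerA.
Qed.

Lemma twist1 l : twist 1%g l = l.
Proof.
rewrite /twist -[RHS]map_id; apply: eq_map => -[g x] /=.
by rewrite scale1r.
Qed.

Definition lmul l m := [seq (p.1 + q.1, p.2 ** q.2) | p <- l, q <- m].

Lemma graded_lmul l m : graded l -> graded m -> graded (lmul l m).
Proof.
by move=> hl hm _ /allpairsP[[p q] [/= /hl hp /hm hq ->]]; exact: A_mul.
Qed.

Lemma cmul_suml (I : Type) (s : seq I) (F : I -> A) x :
  (\sum_(i <- s) F i) ** x = \sum_(i <- s) (F i ** x).
Proof.
elim: s => [|i s IH]; first by rewrite !big_nil cmul0l.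
by rewrite !big_cons cmulDl IH.
Qed.

Lemma cmul_sumr (I : Type) (s : seq I) (F : I -> A) x :
  x ** (\sum_(i <- s) F i) = \sum_(i <- s) (x ** F i).
Proof.
elim: s => [|i s IH]; first by rewrite !big_nil cmul0r.
by rewrite !big_cons cmulDr IH.
Qed.

Lemma gsum_lmul l m : gsum (lmul l m) = gsum l ** gsum m.
Proof.
rewrite /gsum /lmul big_allpairs_dep cmul_suml; apply: eq_bigr => p _.
by rewrite cmul_sumr.
Qed.

Lemma gsum_twist_lmul chi l m :
  gsum (twist chi (lmul l m)) = gsum (twist chi l) ** gsum (twist chi m).
Proof.
rewrite -gsum_lmul /gsum /twist !big_map /lmul big_allpairs_dep [RHS]big_allpairs_dep.
rewrite big_map; apply: eq_bigr => p _; rewrite big_map; apply: eq_bigr => q _ /=.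
by rewrite charD cmulZl cmulZr scalerA.
Qed.

Definition lstar l := [seq (- p.1, star p.2) | p <- l].

Lemma graded_lstar l : graded l -> graded (lstar l).
Proof.
by move=> hl _ /mapP[p /hl hp ->] /=; rewrite -A_star; exists p.2.
Qed.

Lemma star0 : star 0 = 0 :> A.
Proof. by have := starB (0 : A) 0; rewrite !subrr. Qed.

Lemma star_sum (I : Type) (s : seq I) (F : I -> A) :
  star (\sum_(i <- s) F i) = \sum_(i <- s) star (F i).
Proof.
elim: s => [|i s IH]; first by rewrite !big_nil star0.
by rewrite !big_cons starD IH.
Qed.

Lemma gsum_lstar l : gsum (lstar l) = star (gsum l).
Proof. by rewrite /gsum big_map star_sum. Qed.

Lemma char0 chi : chi 0 = 1.
Proof.
by apply: (mulfI (char_neq0 chi 0)); rewrite -charD addr0 mulr1.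
Qed.

Lemma charN chi g : chi (- g) = conjc (chi g).
Proof.
apply: (mulfI (char_neq0 chi g)); rewrite -charD subrr char0 -[conjc _]/((chi g)^*).
by rewrite -normCK char_norm expr1n.
Qed.

Lemma twist_lstar chi l : twist chi (lstar l) = lstar (twist chi l).
Proof.
rewrite /twist /lstar -!map_comp; apply: eq_map => p /=.
by rewrite starZ charN.
Qed.

(** * The expectation on the algebraic sum *)

Lemma E_lin : linear E. Proof. by have [[]] := E_cond. Qed.
Lemma E_contr x : nm (E x) <= nm x.
Proof. by rewrite -lecR -!nmE; have [_ _ + _ _] := E_cond; apply. Qed.
Lemma E_D x y : E (x + y) = E x + E y.
Proof. by have := E_lin 1 x y; rewrite !scale1r. Qed.
Lemma E_0 : E 0 = 0.
Proof. by apply: (@addrI _ (E 0)); rewrite -E_D !addr0. Qed.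
Lemma E_Z (c : R[i]) x : E (c *: x) = c *: E x.
Proof. by have := E_lin c x 0; rewrite E_0 !addr0. Qed.
Lemma E_B x y : E (x - y) = E x - E y.
Proof. by rewrite E_D -scaleN1r E_Z scaleN1r. Qed.

Lemma E_homogeneous g x : A_ g x -> E x = if g == 0 then x else 0.
Proof.
move=> Ax; pose a h := if h == g then x else 0.
have ga : graded_family A_ a.
  split; last by move=> h; rewrite /a; case: eqP => [->|_] //; exact: A_0.
  apply: (sub_finite_set _ (finite_set1 g)) => h /=; rewrite /a.
  by case: (h =P g) => // _; rewrite eqxx.
have := E_proj ga; rewrite -(fsbig_widen [set g] setT) //; last first.
  by move=> h [_ /eqP hg]; rewrite /= /a (negPf hg).
by rewrite fsbig_set1 /= /a eqxx eq_sym.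
Qed.

Lemma E_gsum_twist chi l : graded l -> E (gsum (twist chi l)) = E (gsum l).
Proof.
elim: l => [//|p l IH] /graded_consP[hp /IH {}IH].
rewrite /= !gsum_cons !E_D IH E_Z (E_homogeneous hp) /=; congr (_ + _).
by case: eqP => [->|_]; rewrite ?char0 ?scale1r // scaler0.
Qed.

(** * The closed graph of a twist, and isometry *)

Lemma algebraic_sum_gsum x : algebraic_sum A_ x -> exists2 l, graded l & gsum l = x.
Proof.
move=> [a [fa ga] <-].
exists [seq (g, a g) | g <- finmap.enum_fset (fset_set [set g | a g != 0])].
  by move=> _ /mapP[g _ ->] /=.
rewrite /gsum big_map -(fsbig_widen [set g | a g != 0] setT) ?fsbig_finite //.
by move=> g [_ /negP/negPn/eqP].
Qed.

Lemma gsum_dense x (e : R) : 0 < e -> exists2 l, graded l & nm (x - gsum l) < e.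
Proof.
move=> e0; have [y /algebraic_sum_gsum[l gl <-] h] := nm_dense x A_dense e0.
by exists l.
Qed.

(* The closure in [A * A] of the graph of the twist by [chi]. *)
Definition gclosure chi x y : Prop := forall e : R, 0 < e ->
  exists2 l, graded l & nm (x - gsum l) < e /\ nm (y - gsum (twist chi l)) < e.

Lemma gclosure_gsum chi l : graded l -> gclosure chi (gsum l) (gsum (twist chi l)).
Proof. by move=> gl e e0; exists l; rewrite ?subrr ?nm0. Qed.

Lemma gclosureD chi x x' y y' : gclosure chi x x' -> gclosure chi y y' ->
  gclosure chi (x + y) (x' + y').
Proof.
move=> hx hy e e0; have e2 : 0 < e / 2 by lra.
have [l gl [l1 l2]] := hx _ e2; have [m gm [m1 m2]] := hy _ e2.
exists (l ++ m); first exact: graded_cat.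
rewrite twist_cat !gsum_cat !opprD ![_ + (- _ - _)]addrACA.
have := nmD (x - gsum l) (y - gsum m).
have := nmD (x' - gsum (twist chi l)) (y' - gsum (twist chi m)).
by split; lra.
Qed.

Lemma gclosureZ chi (c : R[i]) x x' : gclosure chi x x' ->
  gclosure chi (c *: x) (c *: x').
Proof.
move=> hx e e0.
have c0 : 0 <= complex.Re `|c| by have := normr_ge0 c; rewrite lecE => /andP[].
have c1 : 0 < complex.Re `|c| + 1 by lra.
have [l gl [l1 l2]] := hx _ (divr_gt0 e0 c1).
rewrite !ltr_pdivlMr // in l1 l2.
exists (lscale c l); first exact: graded_lscale.
rewrite twist_lscale !gsum_lscale -!scalerBr !nmZ.
have := nm_ge0 (x - gsum l); have := nm_ge0 (x' - gsum (twist chi l)).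
by split; nra.
Qed.

Lemma gclosure_lim chi (u u' : nat -> A) x x' :
  (forall n, gclosure chi (u n) (u' n)) ->
  u n @[n --> \oo] --> x -> u' n @[n --> \oo] --> x' -> gclosure chi x x'.
Proof.
move=> hu /nm_cvg ux /nm_cvg ux' e e0; have e2 : 0 < e / 2 by lra.
have [N1 h1] := ux _ e2; have [N2 h2] := ux' _ e2.
set n := maxn N1 N2; have [l gl [l1 l2]] := hu n _ e2.
have := h1 n (leq_maxl _ _); have := h2 n (leq_maxr _ _).
rewrite nmB [nm (u n - _)]nmB => h3 h4; exists l => //.
have := nm_triangle (u n) x (gsum l).
have := nm_triangle (u' n) x' (gsum (twist chi l)).
by split; lra.
Qed.

Lemma gclosure_mul chi l x x' : graded l -> gclosure chi x x' ->
  gclosure chi (gsum l ** x) (gsum (twist chi l) ** x').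
Proof.
move=> gl hx e e0; set b := gsum l; set b' := gsum (twist chi l).
have c1 : 0 < nm b + nm b' + 1 by have := nm_ge0 b; have := nm_ge0 b'; lra.
have [m gm [l1 l2]] := hx _ (divr_gt0 e0 c1).
rewrite !ltr_pdivlMr // in l1 l2.
exists (lmul l m); first exact: graded_lmul.
rewrite gsum_twist_lmul gsum_lmul -!cmulBr -/b -/b'.
have := nm_cmul b (x - gsum m); have := nm_cmul b' (x' - gsum (twist chi m)).
have := nm_ge0 (x - gsum m); have := nm_ge0 (x' - gsum (twist chi m)).
have := nm_ge0 b; have := nm_ge0 b'.
by split; nra.
Qed.

(** If [u] is near [x] and its twist [v] is near [0], then [E (x^* x)] is near
    [E (u^* u) = E (v^* v)], hence near [0], and [E] is faithful. *)
Lemma gclosure_inj chi x : gclosure chi x 0 -> x = 0.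
Proof.
move=> hx; apply: E_faithful; apply: nm_small => e e0.
have c1 : 0 < 2 * nm x + 2 by have := nm_ge0 x; lra.
(* The cap [1] gives [|u| <= |x| + 1] and [|v|^2 <= |v|]. The total error is then at most
   [(2 |x| + 1) |x - u| + |v|], which is below [e]. *)
have d0 : 0 < Num.min 1 (e / (2 * nm x + 2)) by rewrite lt_min ltr01 divr_gt0.
have [l gl []] := hx _ d0; rewrite sub0r nmN !lt_min => /andP[u1 u2] /andP[v1 v2].
rewrite ltr_pdivlMr // in u2; rewrite ltr_pdivlMr // in v2.
set u := gsum l in u1 u2; set v := gsum (twist chi l) in v1 v2.
have e1 : E (star u ** u) = E (star v ** v).
  rewrite /u /v -!gsum_lstar -twist_lstar -gsum_twist_lmul -gsum_lmul E_gsum_twist //.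
  by apply: graded_lmul => //; exact: graded_lstar.
have h1 : nm (E (star u ** u)) <= nm v * nm v.
  by rewrite e1 -expr2 -nm_star_cmul; exact: E_contr.
have h2 : nm (E (star x ** x) - E (star u ** u)) <= nm (x - u) * nm x + nm u * nm (x - u).
  rewrite -E_B; apply: le_trans (E_contr _) _.
  have -> : star x ** x - star u ** u = star (x - u) ** x + star u ** (x - u).
    by rewrite starB cmulBl cmulBr subrKA.
  apply: le_trans (nmD _ _) _.
  by apply: lerD; apply: le_trans (nm_cmul _ _) _; rewrite nm_star.
have h3 : nm u <= nm x + nm (x - u) by have := nmD x (u - x); rewrite subrKC [nm (u - x)]nmB.
have := nmD (E (star x ** x) - E (star u ** u)) (E (star u ** u)); rewrite subrK.
have := nm_ge0 x; have := nm_ge0 v; have := nm_ge0 (x - u); have := nm_ge0 u.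
set t := nm (x - u) in u1 u2 h2 h3 *; set X := nm x in c1 u2 v2 h2 h3 *.
set w := nm v in v1 v2 h1 *; set U := nm u in h2 h3 *.
move=> U0 t0 w0 X0 h4.
have h5 : w * w <= w by nra.
have h6 : U * t <= (X + 1) * t by apply: ler_wpM2r => //; lra.
have h7 : w * (2 * X + 2) < e by [].
by nra.
Qed.

(** The C*-identity reduces one inequality to the self-adjoint element [u^* u], where
    [norm_le_of_closed_rel] applies; the inverse character gives the other. *)
Lemma twist_isometric chi l : graded l -> nm (gsum (twist chi l)) = nm (gsum l).
Proof.
have le chi' m : graded m -> nm (gsum m) <= nm (gsum (twist chi' m)).
  move=> gm; have gs := graded_lstar gm.
  rewrite -(@ler_pXn2r _ 2) ?nnegrE ?nm_ge0 // -!nm_star_cmul -!gsum_lstar -twist_lstar.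
  rewrite -gsum_twist_lmul -gsum_lmul; have gM := graded_lmul gs gm.
  apply: (@norm_le_of_closed_rel _ _ (gclosure chi')).
  - by rewrite -gsum_nil; exact: (@gclosure_gsum chi' [::] graded_nil).
  - by move=> *; exact: gclosureD.
  - by move=> *; exact: gclosureZ.
  - by move=> *; apply: gclosure_lim; eassumption.
  - by move=> *; exact: gclosure_mul.
  - exact: gclosure_gsum.
  - exact: gclosure_inj.
  - by rewrite gsum_lmul gsum_lstar starM starK.
  - by rewrite gsum_twist_lmul twist_lstar gsum_lstar starM starK.
move=> gl; apply/eqP; rewrite eq_le le // andbT.
rewrite -{2}[l]twist1 -(mulVg chi) twist_mul; apply: le; exact: graded_twist.
Qed.

Lemma gclosure_isometric chi x x' : gclosure chi x x' -> nm x' = nm x.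
Proof.
move=> h; apply/eqP; rewrite eq_le; apply/andP; split; apply/ler_addgt0Pr => e e0;
  have e2 : 0 < e / 2 by [lra]; have [l gl [l1 l2]] := h _ e2;
  have := twist_isometric chi gl;
  set u := gsum l in l1 *; set v := gsum (twist chi l) in l2 * => uv.
- have := nmD (x' - v) v; have := nmD (u - x) x; rewrite !subrK [nm (u - x)]nmB; lra.
- have := nmD (x - u) u; have := nmD (v - x') x'; rewrite !subrK [nm (v - x')]nmB; lra.
Qed.

Lemma gclosure_fun chi x y z : gclosure chi x y -> gclosure chi x z -> y = z.
Proof.
move=> hy /(gclosureZ (-1)) hz; have := gclosureD hy hz.
rewrite !scaleN1r subrr => /gclosure_isometric; rewrite nm0 => /nm_eq0 /eqP.
by rewrite subr_eq0 => /eqP.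
Qed.

(** A difference of two twisted sums is the twisted sum of one list, so isometry makes the twists of
    approximants of [x] a Cauchy sequence. *)
Lemma gclosure_total chi x : exists x', gclosure chi x x'.
Proof.
have h n : exists l, graded l /\ nm (x - gsum l) < n.+1%:R^-1.
  by have [|l gl hl] := gsum_dense x (e := n.+1%:R^-1); [rewrite invr_gt0 ltr0n|exists l].
pose l n := projT1 (cid (h n)); have gl n : graded (l n) := (projT2 (cid (h n))).1.
have hl n : nm (x - gsum (l n)) < n.+1%:R^-1 := (projT2 (cid (h n))).2.
have [x' hx'] : exists x' : A, gsum (twist chi (l n)) @[n --> \oo] --> x'.
  apply: nm_cauchy => e e0; have e2 : 0 < e / 2 by lra.
  have [N hN] := inv_succ_small e2; exists N => m n Nm Nn.
  have -> : gsum (twist chi (l m)) - gsum (twist chi (l n)) =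
      gsum (twist chi (l m ++ lscale (-1) (l n))).
    by rewrite twist_cat gsum_cat twist_lscale gsum_lscale scaleN1r.
  rewrite twist_isometric; last by apply: graded_cat => //; exact: graded_lscale.
  rewrite gsum_cat gsum_lscale scaleN1r.
  have := nm_triangle x (gsum (l m)) (gsum (l n)).
  have := lt_trans (hl m) (hN m Nm); have := lt_trans (hl n) (hN n Nn).
  rewrite [nm (gsum (l m) - x)]nmB; lra.
exists x' => e e0; have [N1 h1] := inv_succ_small e0.
have /nm_cvg /(_ _ e0) [N2 h2] := hx'.
set n := maxn N1 N2; exists (l n); first exact: gl.
split; first exact: lt_trans (hl n) (h1 n (leq_maxl _ _)).
by rewrite nmB; exact: (h2 n (leq_maxr _ _)).
Qed.

(** * The action on the whole algebra, and its uniqueness *)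

Definition dual_action chi x : A := projT1 (cid (gclosure_total chi x)).

Lemma dual_actionP chi x : gclosure chi x (dual_action chi x).
Proof. exact: projT2 (cid (gclosure_total chi x)). Qed.

Lemma dual_actionE chi x x' : gclosure chi x x' -> dual_action chi x = x'.
Proof. exact: gclosure_fun (dual_actionP chi x). Qed.

Lemma dual_action_gsum chi l : graded l -> dual_action chi (gsum l) = gsum (twist chi l).
Proof. by move=> /(gclosure_gsum chi) /dual_actionE. Qed.

Lemma dual_action_homogeneous chi g x : A_ g x -> dual_action chi x = chi g *: x.
Proof.
move=> Ax; have := @dual_action_gsum chi [:: (g, x)].
by rewrite /gsum /= !big_seq1 /=; apply; apply: graded_cons.
Qed.

Lemma nm_dual_action chi x : nm (dual_action chi x) = nm x.
Proof. exact: gclosure_isometric (dual_actionP chi x). Qed.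

Lemma dual_actionD chi x y :
  dual_action chi (x + y) = dual_action chi x + dual_action chi y.
Proof. by apply: dual_actionE; apply: gclosureD; exact: dual_actionP. Qed.

Lemma dual_actionZ chi (c : R[i]) x :
  dual_action chi (c *: x) = c *: dual_action chi x.
Proof. by apply: dual_actionE; apply: gclosureZ; exact: dual_actionP. Qed.

Lemma dual_actionB chi x y :
  dual_action chi (x - y) = dual_action chi x - dual_action chi y.
Proof. by rewrite -scaleN1r dual_actionD dual_actionZ scaleN1r. Qed.

Lemma dense_ext (f f' : A -> A) (C : R) :
  (forall x y, nm (f x - f y) <= C * nm (x - y)) ->
  (forall x y, nm (f' x - f' y) <= C * nm (x - y)) ->
  (forall l, graded l -> f (gsum l) = f' (gsum l)) -> forall x, f x = f' x.
Proof.
move=> hf hf' e x; apply/eqP; rewrite -subr_eq0; apply/eqP.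
apply: nm_small => d d0; have c1 : 0 < 2 * `|C| + 1 by have := normr_ge0 C; lra.
have [l gl] := gsum_dense x (divr_gt0 d0 c1); rewrite ltr_pdivlMr // => h.
have := nm_triangle (f (gsum l)) (f x) (f' x).
have := hf x (gsum l); have := hf' (gsum l) x; rewrite -e // [nm (gsum l - x)]nmB.
have := ler_wpM2r (nm_ge0 (x - gsum l)) (ler_norm C).
have := nm_ge0 (x - gsum l); nra.
Qed.

Lemma dual_actionM chi x y :
  dual_action chi (x ** y) = dual_action chi x ** dual_action chi y.
Proof.
have lip z a b : nm (z ** a - z ** b) <= nm z * nm (a - b) by rewrite -cmulBr nm_cmul.
have lipr z a b : nm (a ** z - b ** z) <= nm z * nm (a - b).
  by rewrite -cmulBl mulrC nm_cmul.
have main l : graded l ->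
    dual_action chi (gsum l ** y) = dual_action chi (gsum l) ** dual_action chi y.
  move=> gl; move: y; set z := gsum l.
  apply: (@dense_ext (fun y => dual_action chi (z ** y))
    (fun y => dual_action chi z ** dual_action chi y) (nm z)) => [a b|a b|m gm].
  - by rewrite -dual_actionB nm_dual_action.
  - by apply: le_trans (lip _ _ _) _; rewrite -dual_actionB !nm_dual_action.
  - rewrite -gsum_lmul !dual_action_gsum // ?gsum_twist_lmul //.
    exact: graded_lmul.
apply: (@dense_ext (fun x => dual_action chi (x ** y))
  (fun x => dual_action chi x ** dual_action chi y) (nm y)) main x => a b.
  by rewrite -dual_actionB nm_dual_action.
by apply: le_trans (lipr _ _ _) _; rewrite -dual_actionB !nm_dual_action.
Qed.

Lemma dual_action_star chi x : dual_action chi (star x) = star (dual_action chi x).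
Proof.
apply: (@dense_ext (fun x => dual_action chi (star x))
  (fun x => star (dual_action chi x)) 1) => [a b|a b|l gl].
- by rewrite -dual_actionB nm_dual_action -starB nm_star mul1r.
- by rewrite -starB nm_star -dual_actionB nm_dual_action mul1r.
- rewrite -gsum_lstar !dual_action_gsum // ?twist_lstar ?gsum_lstar //.
  exact: graded_lstar.
Qed.

Lemma dual_action_comp chi eta x :
  dual_action (chi * eta)%g x = dual_action chi (dual_action eta x).
Proof.
apply: (@dense_ext (dual_action (chi * eta)%g)
  (fun x => dual_action chi (dual_action eta x)) 1) => [a b|a b|l gl].
- by rewrite -dual_actionB nm_dual_action mul1r.
- by rewrite -!dual_actionB !nm_dual_action mul1r.
- by rewrite !dual_action_gsum ?twist_mul //; exact: graded_twist.
Qed.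

Lemma dual_action1 x : dual_action 1%g x = x.
Proof.
apply: (@dense_ext (dual_action 1%g) id 1) => [a b|a b|l gl].
- by rewrite -dual_actionB nm_dual_action mul1r.
- by rewrite mul1r.
- by rewrite dual_action_gsum // twist1.
Qed.

Lemma dual_action_auto chi : star_automorphism (dual_action chi).
Proof.
split; first by move=> c x y; rewrite dual_actionD dual_actionZ.
- exact: dual_actionM.
- exact: dual_action_star.
exists (dual_action chi^-1%g) => x.
- by rewrite -dual_action_comp mulVg dual_action1.
- by rewrite -dual_action_comp mulgV dual_action1.
Qed.

(** Each [beta chi] is contractive by [star_hom_contractive], hence determined by its values on
    homogeneous elements. *)
Lemma dual_action_unique (beta : dual R G -> A -> A) :
  (forall chi, star_automorphism (beta chi)) ->
  (forall chi g x, A_ g x -> beta chi x = chi g *: x) -> beta = dual_action.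
Proof.
move=> auto spec; apply/funext => chi; apply/funext => x.
have [lin bM bS _] := auto chi.
have contr := star_hom_contractive lin bM bS.
have bD y z : beta chi (y + z) = beta chi y + beta chi z.
  by have := lin 1 y z; rewrite !scale1r.
have b0 : beta chi 0 = 0 by apply: (@addrI _ (beta chi 0)); rewrite -bD !addr0.
have bB y z : beta chi (y - z) = beta chi y - beta chi z.
  by rewrite bD; have := lin (-1) z 0; rewrite b0 !addr0 !scaleN1r => ->.
apply: (@dense_ext (beta chi) (dual_action chi) 1) => [a b|a b|l gl].
- by rewrite -bB mul1r.
- by rewrite -dual_actionB nm_dual_action mul1r.
- rewrite dual_action_gsum //; elim: l gl => [_|p l IH /graded_consP[hp /IH {}IH]].
    by rewrite gsum_nil.
  by rewrite /= !gsum_cons bD IH /= (spec _ p.1).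
Qed.

(** * Spectral subspaces by finite averaging *)

(** What is retained of the averages of [chi g^-1 alpha_chi] and of their compositions; [a] is the
    candidate spectral vector, which they fix. *)
Record averaging g (a : A) (T : A -> A) : Prop := Averaging {
  avgD : forall x y, T (x + y) = T x + T y ;
  avg_le : forall x, nm (T x) <= nm x ;
  avg_fix : T a = a ;
  avg_graded : forall h x, A_ h x -> A_ h (T x) ;
  avg_id : forall x, A_ g x -> T x = x }.

Lemma averaging_id g a : averaging g a id.
Proof. by []. Qed.

Lemma averaging_comp g a T T' : averaging g a T -> averaging g a T' ->
  averaging g a (fun x => T (T' x)).
Proof.
move=> [TD Tle Ta Tg Tid] [TD' Tle' Ta' Tg' Tid']; split.
- by move=> x y; rewrite TD' TD.
- by move=> x; apply: le_trans (Tle _) _.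
- by rewrite Ta' Ta.
- by move=> h x /Tg' /Tg.
- by move=> x Ax; rewrite Tid' // Tid.
Qed.

(** Strict convexity of the disc: the midpoint of two distinct points of the circle is interior. *)
Lemma half_norm_lt1 (w : R[i]) : `|w| = 1 -> w != 1 ->
  complex.Re `|(2^-1)%:C%C * (1 + w)| < 1.
Proof.
case: w => u v; rewrite normc_def => /(congr1 (@complex.Re R)) /= n1 w1.
have {n1} n1 : u ^+ 2 + v ^+ 2 = 1.
  by rewrite -[LHS]sqr_sqrtr ?n1 ?expr1n // addr_ge0 ?sqr_ge0.
have u1 : u < 1.
  rewrite lt_neqAle; apply/andP; split.
    apply: contra w1 => /eqP u1; rewrite eq_complex /= u1 eqxx /=.
    by rewrite -sqrf_eq0; apply/eqP; move: n1; rewrite u1; lra.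
  by have := sqr_ge0 v; nra.
rewrite -[ltRHS]sqrtr1 ltr_sqrt //; nra.
Qed.

(** If [chi (h - g) != 1], the mean [Q] of the identity and [chi g^-1 alpha_chi] acts on degree [h]
    by a scalar of modulus below [1], so its iterates tend to [0] there. *)
Lemma averaging_kill1 g a h x (e : R) :
  (forall chi, dual_action chi a = chi g *: a) -> h != g -> A_ h x -> 0 < e ->
  exists2 T, averaging g a T & nm (T x) < e.
Proof.
move=> fa hg Ax e0; have [chi c1] : exists chi : dual R G, chi (h - g) != 1.
  by apply: dual_separates; rewrite subr_eq0.
pose Q y := (2^-1)%:C%C *: (y + (chi g)^-1 *: dual_action chi y).
have half y : (2^-1 : R)%:C%C *: (y + y) = y :> A.
  rewrite -{1 2}[y]scale1r -scalerDl scalerA.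
  rewrite -[1 + 1](rmorphD (real_complex R) 1 1) -rmorphM /=.
  by rewrite (_ : 2^-1 * (1 + 1) = 1) ?scale1r //; field.
have Qg k y : A_ k y -> Q y = ((2^-1)%:C%C * (1 + (chi g)^-1 * chi k)) *: y.
  move=> Ay; rewrite /Q (dual_action_homogeneous chi Ay) scalerA.
  by rewrite -{1}[y]scale1r -scalerDl scalerA.
have aQ : averaging g a Q.
  split.
  - move=> y z; rewrite /Q dual_actionD -scalerDr; congr (_ *: _).
    by rewrite scalerDr addrACA.
  - move=> y; rewrite /Q nmZr ger0_norm ?invr_ge0 //.
    have := nmD y ((chi g)^-1 *: dual_action chi y).
    rewrite nmZ normfV char_norm invr1 mul1r nm_dual_action; lra.
  - by rewrite /Q fa scalerA mulVf ?char_neq0 // scale1r half.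
  - by move=> k y Ay; rewrite (Qg k) //; exact: A_Z.
  - move=> y Ay; rewrite /Q (dual_action_homogeneous chi Ay).
    by rewrite scalerA mulVf ?char_neq0 // scale1r half.
pose c := (2^-1)%:C%C * (1 + (chi g)^-1 * chi h) : R[i].
have lt1 : complex.Re `|c| < 1.
  apply: half_norm_lt1; first by rewrite normrM normfV !char_norm invr1 mulr1.
  apply: contra c1 => /eqP e1; rewrite -(inj_eq (mulfI (char_neq0 chi g))) -charD.
  by rewrite addrC subrK -e1 mulrA mulfV ?char_neq0 // mul1r.
have c0 : 0 <= complex.Re `|c| by have := normr_ge0 c; rewrite lecE => /andP[].
have Qn n : averaging g a (iter n Q).
  elim: n => [|n IH]; first exact: averaging_id.
  exact: averaging_comp aQ IH.
have nQ n : nm (iter n Q x) = complex.Re `|c| ^+ n * nm x.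
  elim: n => [|n IH]; first by rewrite expr0 mul1r.
  rewrite iterS (Qg h); last exact: (avg_graded (Qn n)).
  by rewrite nmZ IH exprS mulrA.
have x1 : 0 < nm x + 1 by have := nm_ge0 x; lra.
have : `|complex.Re `|c| | < 1 by rewrite ger0_norm.
move=> /cvg_expr /cvgrPdist_lt /(_ _ (divr_gt0 e0 x1)) [n _ /(_ n (leqnn _))] /=.
rewrite sub0r normrN ger0_norm ?exprn_ge0 // ltr_pdivlMr // => hn.
exists (iter n Q) => //; rewrite nQ; apply: le_lt_trans hn.
by rewrite ler_wpM2l ?exprn_ge0 //; lra.
Qed.

(** Terms are treated one at a time: the previous average leaves the next term in its degree, and
    the new one, being contractive, keeps what is already small small. *)
Lemma averaging_kill g a l (e : R) :
  (forall chi, dual_action chi a = chi g *: a) -> graded l ->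
  (forall p, p \in l -> p.1 != g) -> 0 < e ->
  exists2 T, averaging g a T & nm (T (gsum l)) < e.
Proof.
move=> fa; elim: l e => [|p l IH] e.
  by move=> _ _ e0; exists id; [exact: averaging_id|rewrite gsum_nil nm0].
move=> /graded_consP[hp gl] ne e0; have e2 : 0 < e / 2 by lra.
have [|T aT hT] := IH _ gl _ e2.
  by move=> q ql; apply: ne; rewrite inE ql orbT.
have pg : p.1 != g by apply: ne; rewrite inE eqxx.
have [T' aT' hT'] := averaging_kill1 fa pg (avg_graded aT hp) e2.
exists (fun x => T' (T x)); first exact: averaging_comp.
rewrite gsum_cons (avgD aT) (avgD aT').
have := nmD (T' (T p.2)) (T' (T (gsum l))).
have := avg_le aT' (T (gsum l)); lra.
Qed.

Lemma dual_action_spectral : has_spectral_subspaces A_ dual_action.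
Proof.
move=> g; apply/seteqP; split => [x Ax chi|a /= fa].
  exact: dual_action_homogeneous.
apply: nm_closed => // e e0; have e2 : 0 < e / 2 by lra.
have [l gl hl] := gsum_dense a e2.
pose l1 := [seq p <- l | p.1 == g]; pose l2 := [seq p <- l | p.1 != g].
have el : gsum l = gsum l1 + gsum l2.
  by rewrite /gsum (bigID (fun p => p.1 == g)) /= !big_filter.
have Al1 : A_ g (gsum l1).
  rewrite /gsum big_filter; elim: (l) gl => [|p s IH]; first by rewrite big_nil => _; exact: A_0.
  move=> /graded_consP[hp /IH {}IH]; rewrite big_cons; case: eqP => // pg.
  by apply: A_D => //; rewrite -pg.
have gl2 : graded l2 by move=> p; rewrite mem_filter => /andP[_ /gl].
have [|T aT hT] := averaging_kill fa gl2 _ e2.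
  by move=> p; rewrite mem_filter => /andP[].
exists (gsum l1) => //.
have TB x y : T (x - y) = T x - T y.
  by apply/eqP; rewrite eq_sym subr_eq -(avgD aT) subrK.
(* [T] fixes both [a] and the degree [g] part [gsum l1]. Hence [a] is within [e] of the closed
   subspace [A_ g]. *)
have -> : a - gsum l1 = T (a - gsum l) + T (gsum l2).
  rewrite -(avgD aT) el opprD addrA subrK TB (avg_fix aT) (avg_id aT) //.
have := nmD (T (a - gsum l)) (T (gsum l2)).
have := avg_le aT (a - gsum l); lra.
Qed.

(** * Strong continuity *)

Lemma char_continuous g (chi : dual R G) (e : R) : 0 < e ->
  \forall eta \near chi, complex.Re `|(eta : dual R G) g - chi g| < e.
Proof.
move=> e0.
have c1 : {for chi, continuous (fun eta : dual R G => (eta g : R[i]^o))}.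
  apply: (@continuous_comp (dual R G) {ptws G -> R[i]^o} (R[i]^o)
    (@char_fun R G) (fun f => f g)).
    exact: (@initial_continuous (dual R G) {ptws G -> R[i]^o}).
  exact: (@proj_continuous G (fun=> R[i]^o) g).
have e0' : 0 < e%:C%C by rewrite ltcR.
move/cvgrPdist_lt: c1 => /(_ _ e0'); apply: filterS => eta.
by rewrite /= distrC => h; have := h; rewrite ltcE => /andP[].
Qed.

Lemma dual_action_continuous a : continuous (dual_action ^~ a).
Proof.
move=> chi; have FF : Filter (nbhs chi) by exact: nbhs_filter.
apply/(@nm_cvgP _ _ _ _ FF) => e e0; have e3 : 0 < e / 3 by lra.
have [l gl hl] := gsum_dense a e3.
suff H : \forall eta \near chi,
    nm (gsum (twist eta l) - gsum (twist chi l)) < e / 3.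
  apply: filterS H => eta h.
  have := nm_triangle (dual_action eta (gsum l)) (dual_action eta a) (dual_action chi a).
  have := nm_triangle (dual_action chi (gsum l)) (dual_action eta (gsum l)) (dual_action chi a).
  rewrite -!dual_actionB !nm_dual_action !dual_action_gsum // [nm (gsum l - a)]nmB.
  lra.
elim: l gl (e / 3) e3 {hl} => [|p l IH] gl d d0.
  apply: (@filterS _ _ FF _ _ _ (@filterT _ _ FF)) => eta _.
  by rewrite subrr nm0.
have [hp gl'] := graded_consP gl; have d2 : 0 < d / 2 by lra.
have x1 : 0 < nm p.2 + 1 by have := nm_ge0 p.2; lra.
have h1 := IH gl' _ d2; have h2 := char_continuous p.1 chi (divr_gt0 d2 x1).
apply: filterS2 h1 h2 => eta h1; rewrite ltr_pdivlMr // => h2.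
rewrite /= !gsum_cons /= opprD addrACA -scalerBl.
have := nmD ((eta p.1 - chi p.1) *: p.2) (gsum (twist eta l) - gsum (twist chi l)).
rewrite nmZ; have : 0 <= complex.Re `|eta p.1 - chi p.1|.
  by have := normr_ge0 (eta p.1 - chi p.1); rewrite lecE => /andP[].
by have := nm_ge0 p.2; nra.
Qed.

(** * Rounding characters to simple functions *)

Local Notation Xdual := (borel_dual R G).

Lemma measurable_lt (f : dual R G -> R) (c : R) :
  (forall (chi : dual R G) (e : R), 0 < e -> \forall eta \near chi, `|f eta - f chi| < e) ->
  measurable ([set chi | f chi < c] : set Xdual).
Proof.
move=> hf; apply: sub_sigma_algebra; rewrite /= openE => chi /= fc.
have c0 : 0 < c - f chi by rewrite subr_gt0.
have FF : Filter (nbhs chi) by exact: nbhs_filter.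
apply: (@filterS _ _ FF _ _ _ (hf chi _ c0)) => eta /=; rewrite ltr_norml => /andP[_].
by rewrite ltrBrDr subrK.
Qed.

Definition disc N (z : R[i]) : int * int :=
  (Num.floor (N.+1%:R * complex.Re z), Num.floor (N.+1%:R * complex.Im z)).

Definition undisc N (p : int * int) : R[i] :=
  ((p.1%:~R / N.+1%:R) +i* (p.2%:~R / N.+1%:R))%C.

Lemma Re_norm_le (z : R[i]) :
  complex.Re `|z| <= `|complex.Re z| + `|complex.Im z|.
Proof.
rewrite normc_def /= -(@ler_pXn2r _ 2) ?nnegrE ?sqrtr_ge0 ?addr_ge0 //.
rewrite sqr_sqrtr ?addr_ge0 ?sqr_ge0 // sqrrD !real_normK ?num_real //.
by rewrite addrAC lerDl mulrn_wge0 // mulr_ge0.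
Qed.

Lemma abs_Re_le (z : R[i]) : `|complex.Re z| <= complex.Re `|z|.
Proof. by have := normc_ge_Re z; rewrite lecE => /andP[]. Qed.

Lemma abs_Im_le (z : R[i]) : `|complex.Im z| <= complex.Re `|z|.
Proof.
rewrite normc_def /= -(@ler_pXn2r _ 2) ?nnegrE ?sqrtr_ge0 //.
rewrite sqr_sqrtr ?addr_ge0 ?sqr_ge0 // real_normK ?num_real //.
by rewrite lerDr sqr_ge0.
Qed.

Lemma floor_div_close N (y : R) :
  `|(Num.floor (N.+1%:R * y))%:~R / N.+1%:R - y| <= N.+1%:R^-1.
Proof.
have N0 : 0 < N.+1%:R :> R by rewrite ltr0n.
have := floor_itv (N.+1%:R * y); rewrite intrD mulr1z => /andP[].
set k : R := (Num.floor _)%:~R => h1 h2.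
rewrite -[X in `|_ - X|](mulfK (lt0r_neq0 N0)) [y * _]mulrC -mulrBl normrM.
rewrite [`|_^-1|]gtr0_norm ?invr_gt0 // ler_piMl ?invr_ge0 ?ltW //.
rewrite ltr_norml; apply/andP; split; lra.
Qed.

Lemma disc_close N (z : R[i]) :
  complex.Re `|undisc N (disc N z) - z| <= 2 / N.+1%:R.
Proof.
apply: le_trans (Re_norm_le _) _; case: z => u v /=.
have := floor_div_close N u; have := floor_div_close N v.
set a := `|_ - v|; set b := `|_ - u|; set k : R := N.+1%:R^-1.
lra.
Qed.

(** The factor [c] is needed because translating a rounded character by [eta] rounds
    [eta g * chi g], which differs from [eta g] times the rounding of [chi g]. *)
Lemma simple_disc N (c : R[i]) g x : `|c| = 1 ->
  simple ((fun chi => undisc N (disc N (c * chi g)) *: x) : Xdual -> A).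
Proof.
move=> c1; pose t (chi : Xdual) := disc N (c * (chi : dual R G) g).
have cn chi : complex.Re `|c * (chi : dual R G) g| = 1.
  by rewrite normrM c1 char_norm mulr1.
(* These are the [2N + 3] integers from [-(N+1)] to [N+1]; the last one is reached when a coordinate
   equals [1]. *)
pose r1 : seq int := [seq (k : nat)%:Z - N.+1%:Z | k <- iota 0 (N.+1 + N.+2)].
have r1P (y : R) : `|y| <= 1 -> Num.floor (N.+1%:R * y) \in r1.
  rewrite ler_norml => /andP[y1 y2].
  have N0 : 0 < N.+1%:R :> R by rewrite ltr0n.
  have f1 : - N.+1%:Z <= Num.floor (N.+1%:R * y).
    by rewrite floor_ge_int rmorphN /= -pmulrn; nra.
  have f2 : Num.floor (N.+1%:R * y) <= N.+1%:Z.
    rewrite -(ler_int R); apply: le_trans (floor_le _) _.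
    by rewrite -pmulrn; nra.
  apply/mapP; move: (Num.floor _) f1 f2 => k f1 f2; exists (absz (k + N.+1%:Z)).
    by rewrite mem_iota /=; lia.
  by lia.
have mt w : measurable (t @^-1` [set w]).
  have cont chi (e : R) : 0 < e ->
      \forall eta \near chi, complex.Re `|c * (eta : dual R G) g - c * chi g| < e.
    move=> /(char_continuous g chi); apply: filterS => eta.
    by rewrite -mulrBr normrM c1 mul1r.
  have m1 (b : R) : measurable ([set chi | complex.Re (c * (chi : dual R G) g) < b] : set Xdual).
    apply: measurable_lt => chi e /(cont chi); apply: filterS => eta.
    by apply: le_lt_trans; have := abs_Re_le (c * eta g - c * chi g); rewrite raddfB.
  have m2 (b : R) : measurable ([set chi | complex.Im (c * (chi : dual R G) g) < b] : set Xdual).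
    apply: measurable_lt => chi e /(cont chi); apply: filterS => eta.
    by apply: le_lt_trans; have := abs_Im_le (c * eta g - c * chi g); rewrite raddfB.
  have N0 : 0 < N.+1%:R :> R by rewrite ltr0n.
  (* Half-open cells are written with strict sublevel sets and complements, since [measurable_lt]
     covers strict sublevel sets. *)
  have fE (y : R) (k : int) : (Num.floor (N.+1%:R * y) = k) <->
      ~ (y < k%:~R / N.+1%:R) /\ (y < (k + 1)%:~R / N.+1%:R).
    rewrite !ltr_pdivlMr // mulrC; split => [<-|[/negP]].
      by have /andP[h1 h2] := floor_itv (y * N.+1%:R); split => //; apply/negP; rewrite -leNgt.
    by rewrite -leNgt => h1 h2; apply: floor_def; rewrite h1.
  case: w => k l.
  have -> : t @^-1` [set (k, l)] =
      (~` [set chi | complex.Re (c * (chi : dual R G) g) < k%:~R / N.+1%:R] `&`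
       [set chi | complex.Re (c * (chi : dual R G) g) < (k + 1)%:~R / N.+1%:R]) `&`
      (~` [set chi | complex.Im (c * (chi : dual R G) g) < l%:~R / N.+1%:R] `&`
       [set chi | complex.Im (c * (chi : dual R G) g) < (l + 1)%:~R / N.+1%:R]).
    apply/seteqP; split => chi /=.
      by move=> [/fE h1 /fE h2].
    by move=> [/fE h1 /fE h2]; rewrite /t /disc h1 h2.
  by apply: measurableI; apply: measurableI => //; apply: measurableC.
apply: (@simple_label _ _ _ _ _ t (allpairs pair r1 r1) (fun p => undisc N p *: x)) => //.
move=> chi; apply/allpairsP; exists (t chi); split => //=; apply: r1P; rewrite -(cn chi).
  exact: abs_Re_le.
exact: abs_Im_le.
Qed.

(** * Averages against Haar measure *)

Section Haar.
Variable mu : probability Xdual R.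
Hypothesis mu_haar : is_haar mu.

Lemma simple_integral_translate (s s' : Xdual -> A) (eta : dual R G) :
  simple s -> (forall chi, s' chi = s (eta * (chi : dual R G))%g) ->
  simple_integral mu s' = simple_integral mu s.
Proof.
move=> [_ ms] s'E; apply: eq_simple_integral => [v|].
  rewrite /mass -(mu_haar.1 eta^-1%g _ (ms v)); congr (fine (mu _)).
  apply/seteqP; split => chi /=.
    by rewrite s'E => h; exists (eta * (chi : dual R G))%g; rewrite ?mulKg.
  by move=> [chi' h <-]; rewrite s'E mulVKg.
apply/seteqP; split => _ [chi _ <-].
  by exists (eta * (chi : dual R G))%g.
by exists (eta^-1 * (chi : dual R G))%g; rewrite // s'E mulVKg.
Qed.

(** For [g != 0], choose [eta g != 1]. The rounded function and its translate have the same
    integral, while the translate is within [2 D] of [eta g] times the function; hence the integral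
    has norm at most [2 D / |1 - eta g|]. *)
Lemma approx_homogeneous g x (e : R) : A_ g x -> 0 < e -> exists s : Xdual -> A,
  [/\ simple s, forall chi, nm (s chi - (chi : dual R G) g *: x) < e
    & nm (simple_integral mu s - E x) < e].
Proof.
move=> Ax e0; rewrite (E_homogeneous Ax); have [g0|g0] := eqVneq g 0.
  exists (fun=> x); split; first exact: simple_cst.
    by move=> chi; rewrite g0 char0 scale1r subrr nm0.
  by rewrite simple_integral_cst subrr nm0.
have [eta eta1] : exists eta : dual R G, eta g != 1 by exact: dual_separates.
set k := complex.Re `|1 - eta g|.
have k0 : 0 < k.
  have : 0 < `|1 - eta g| by rewrite normr_gt0 subr_eq0 eq_sym.
  by rewrite ltcE => /andP[].
have x1 : 0 < nm x + 1 by have := nm_ge0 x; lra.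
(* The bound [e] serves the uniform estimate; [e * k / 2] serves the integral, where [2 D] is
   divided by [k]. *)
pose b := Num.min e (e * k / 2).
have b0 : 0 < b by rewrite lt_min e0 divr_gt0 ?mulr_gt0.
pose N := Num.trunc (2 * (nm x + 1) / b).
have hN : 2 * (nm x + 1) / b < N.+1%:R by exact: truncnS_gt.
pose D := 2 / N.+1%:R * nm x.
have N0 : 0 < N.+1%:R :> R by rewrite ltr0n.
have Db : D < b.
  rewrite /D mulrAC ltr_pdivrMr //; rewrite ltr_pdivrMr // in hN.
  by rewrite mulrC in hN; have := nm_ge0 x; lra.
have /andP[De Dk] : (D < e) && (D < e * k / 2) by rewrite -lt_min.
pose s c : Xdual -> A := fun chi => undisc N (disc N (c * chi g)) *: x.
have sc c (chi : dual R G) : nm (s c chi - (c * chi g) *: x) <= D.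
  by rewrite /s -scalerBl nmZ ler_wpM2r ?nm_ge0 ?disc_close.
have ss c : `|c| = 1 -> simple (s c) by exact: simple_disc.
have s1 := ss 1 (normr1 _); have s2 := ss (eta g) (char_norm _ _).
exists (s 1); split => //.
  by move=> chi; apply: le_lt_trans De; have := sc 1 chi; rewrite mul1r.
have e1 : simple_integral mu (s (eta g)) = simple_integral mu (s 1).
  by apply: (@simple_integral_translate _ _ eta) => // chi; rewrite /s mul1r.
have h : nm (simple_integral mu (s (eta g)) -
    simple_integral mu (fun chi => eta g *: s 1 chi)) <= D + D.
  apply: nm_simple_integralB => //; first exact: simpleZ.
  move=> chi; apply: le_trans (nm_triangle ((eta g * (chi : dual R G) g) *: x) _ _) _.
  apply: lerD; first exact: sc.
  rewrite nmB -scalerA -scalerBr nmZ char_norm mul1r.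
  by have := sc 1 chi; rewrite mul1r.
rewrite e1 simple_integralZ // -{1}[simple_integral _ _]scale1r -scalerBl nmZ -/k in h.
rewrite subr0 -(ltr_pM2l k0); lra.
Qed.

Lemma approx_gsum l (e : R) : graded l -> 0 < e -> exists s : Xdual -> A,
  [/\ simple s, forall chi, nm (s chi - gsum (twist chi l)) < e
    & nm (simple_integral mu s - E (gsum l)) < e].
Proof.
elim: l e => [|p l IH] e.
  move=> _ e0; exists (fun=> 0); rewrite gsum_nil E_0; split; first exact: simple_cst.
    by move=> chi; rewrite subrr nm0.
  by rewrite simple_integral_cst subrr nm0.
move=> /graded_consP[hp gl] e0; have e2 : 0 < e / 2 by lra.
have [s [ss hs is_]] := IH _ gl e2.
have [s' [ss' hs' is']] := approx_homogeneous hp e2.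
exists (fun chi => s' chi + s chi); split; first exact: simpleD.
  move=> chi; rewrite /= gsum_cons /= opprD addrACA.
  by apply: le_lt_trans (nmD _ _) _; have := hs chi; have := hs' chi; lra.
rewrite simple_integralD // gsum_cons E_D opprD addrACA.
by apply: le_lt_trans (nmD _ _) _; lra.
Qed.

Lemma dual_action_average a : is_bochner_integral mu (dual_action ^~ a) (E a).
Proof.
apply: bochner_of_uniform => [w c|e e0].
  apply: measurable_lt => chi e e0.
  have FF : Filter (nbhs chi) by exact: nbhs_filter.
  have := @dual_action_continuous a chi.
  move=> /(@nm_cvgP _ _ _ _ FF) /(_ _ e0); apply: filterS => eta.
  apply: le_lt_trans.
  have := nm_triangle (dual_action chi a) (dual_action eta a) w.
  have := nm_triangle (dual_action eta a) (dual_action chi a) w.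
  rewrite [nm (dual_action chi a - dual_action eta a)]nmB ler_norml => h1 h2.
  by apply/andP; split; lra.
have e2 : 0 < e / 2 by lra.
have [l gl hl] := gsum_dense a e2.
have [s [ss hs is_]] := approx_gsum gl e2.
exists s; split => // [chi|].
  have := nm_triangle (dual_action chi (gsum l)) (dual_action chi a) (s chi).
  rewrite -dual_actionB nm_dual_action dual_action_gsum // [nm (gsum _ - s chi)]nmB.
  by have := hs chi; lra.
have := nm_triangle (E (gsum l)) (simple_integral mu s) (E a).
have := E_contr (gsum l - a); rewrite E_B [nm (gsum l - a)]nmB; lra.
Qed.

End Haar.

End GradedAlgebra.

Theorem theorem11p5 (R : realType) (G : zmodType) (A : cstarAlgType R)
  (A_ : G -> set A) (E : A -> A)
  (A_sub : forall g, linear_subspace (A_ g))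
  (A_closed : forall g, closed (A_ g))
  (A_mul : forall g h a b, A_ g a -> A_ h b -> A_ (g + h) (a ** b))
  (A_star : forall g, star @` A_ g = A_ (- g))
  (A_indep : graded_independent A_)
  (A_dense : dense (algebraic_sum A_))
  (E_cont : continuous E)
  (E_proj : extends_projection A_ E)
  (E_cond : conditional_expectation (A_ 0) E)
  (E_faithful : faithful E) :
  exists alpha : dual R G -> A -> A,
  [/\ strongly_continuous_action alpha /\ has_spectral_subspaces A_ alpha,
      forall beta : dual R G -> A -> A,
        strongly_continuous_action beta -> has_spectral_subspaces A_ beta ->
        beta = alpha
    & forall mu : probability (borel_dual R G) R, is_haar mu ->
        forall a, is_bochner_integral mu (alpha ^~ a) (E a)].
Proof.
exists (dual_action A_sub A_mul A_star A_dense E_proj E_cond E_faithful).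
split; first split; first split.
- exact: dual_action_auto.
- by move=> chi eta; apply/funext => x; exact: dual_action_comp.
- exact: dual_action_continuous.
- exact: dual_action_spectral.
- move=> beta [auto _ _] spec; apply: dual_action_unique => // chi g x.
  by rewrite spec; apply.
- by move=> mu hmu a; exact: dual_action_average.
Qed.
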